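(* Let $p=p(n)\in(0,1]$. (i) If $n^{3/2}p=o(1)$, then whp exactly one of the following two statements holds: either $G_{n,p}$ has no edges, or $q^*(G_{n,p})=q_{\mathcal C}(G_{n,p})=1-1/e(G_{n,p})$. (ii) If $n^2p\to\infty$ and $np\le 1-(\log n)^{1/2}n^{-1/4}$, then whp $q^*(G_{n,p})=q_{\mathcal C}(G_{n,p})=1-\Theta\big(\frac{1}{n^2p(1-np)}\big)$, that is, there are constants $0<\alpha<\beta$ such that whp $q^*(G_{n,p})=q_{\mathcal C}(G_{n,p})$ and $\frac{\alpha}{n^2p(1-np)}\le 1-q_{\mathcal C}(G_{n,p})\le \frac{\beta}{n^2p(1-np)}$. (iii) If $0<\varepsilon\le 1/4$ and $1\le np\le 1+\varepsilon$, then whp $q^*(G_{n,p})\ge q_{\mathcal C}(G_{n,p})>1-(4\varepsilon)^2$.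
   Context: For a graph $G$ with $m\ge 1$ edges and a partition $\mathcal A$ of its vertex set, the modularity score is $q_{\mathcal A}(G)=\frac1m\sum_{A\in\mathcal A}e(A)-\frac{1}{4m^2}\sum_{A\in\mathcal A}\mathrm{vol}(A)^2$, where $e(A)$ is the number of edges within $A$ and $\mathrm{vol}(A)$ is the sum of the degrees of vertices in $A$. The modularity is $q^*(G)=\max_{\mathcal A}q_{\mathcal A}(G)$ over all vertex partitions. $\mathcal C$ denotes the connected components partition of $G$, whose parts are the vertex sets of the connected components of $G$. $e(G)$ is the number of edges of $G$. $G_{n,p}$ is the Erdős–Rényi random graph on $[n]$ with independent edge probability $p$; whp means with probability tending to $1$ as $n\to\infty$. *)

(* Defs.v *)
From HB Require Import structures.
From mathcomp Require Import all_boot all_order all_algebra.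
From mathcomp Require Import all_classical all_reals all_analysis.

Set Implicit Arguments.
Unset Strict Implicit.
Unset Printing Implicit Defensive.

Import Order.TTheory GRing.Theory Num.Theory.
Import numFieldNormedType.Exports.

Local Open Scope ring_scope.

(* Finite simple graphs on the vertex set T: edges are unordered pairs of
   distinct vertices. *)
Record graph (T : finType) := Graph {
  edges :> {set {set T}};
  _ : [forall e in edges, #|e| == 2]
}.

HB.instance Definition _ (T : finType) := [isSub for @edges T].
HB.instance Definition _ (T : finType) := [Finite of graph T by <:].

Section Graph.
Variables (T : finType) (G : graph T).

Lemma card_edge (e : {set T}) : e \in edges G -> #|e| = 2.
Proof. by case: G => E /= /forall_inP hE /hE/eqP. Qed.

Definition adj (x y : T) : bool := [set x; y] \in edges G.

Lemma adj_sym : symmetric adj.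
Proof. by move=> x y; rewrite /adj finset.setUC. Qed.

Lemma adj_irr : irreflexive adj.
Proof.
move=> x; rewrite /adj finset.setUid; apply/negP => /card_edge.
by rewrite cards1.
Qed.

Definition nb_edges : nat := #|edges G|.

Definition degree (x : T) : nat := #|[set y | adj x y]|.

Definition edges_in (A : {set T}) : nat :=
  #|[set e in edges G | e \subset A]|.

Definition volume (A : {set T}) : nat := (\sum_(x in A) degree x)%N.

Definition components : {set {set T}} :=
  equivalence_partition (connect adj) [set: T].

Lemma components_partition : finset.partition components [set: T].
Proof.
apply/equivalence_partitionP => x y z _ _ _; split=> // xy.
exact: (same_connect (sym_connect_sym adj_sym) xy z).
Qed.

Definition singletons : {set {set T}} := [set [set x] | x in [set: T]].

Lemma singletons_partition : finset.partition singletons [set: T].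
Proof.
apply/and3P; split.
- apply/eqP/setP => x; rewrite inE; apply/bigcupP.
  by exists [set x]; rewrite ?inE //; apply: imset_f; rewrite inE.
- apply/finset.trivIsetP => _ _ /imsetP[x _ ->] /imsetP[y _ ->] xy.
  by rewrite disjoints1 inE; apply: contraNneq xy => ->.
- by apply/imsetP => -[x _ /setP /(_ x)]; rewrite !inE eqxx.
Qed.

Variable R : realType.

(* The modularity score of G is defined for graphs with at least one edge; when
   nb_edges = 0, division by zero makes it 0. *)
Definition mod_score (P : {set {set T}}) : R :=
  nb_edges%:R^-1 * (\sum_(A in P) (edges_in A)%:R)
  - (4 * nb_edges%:R ^+ 2)^-1 * (\sum_(A in P) (volume A)%:R ^+ 2).

(* The default value is the score of a vertex partition, so this is a genuine
   maximum (see [modularity_attained] and [modularity_ge]). *)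
Definition modularity : R :=
  \big[Num.max/mod_score singletons]_(P | finset.partition P [set: T])
    mod_score P.

Lemma modularity_ge (P : {set {set T}}) :
  finset.partition P [set: T] -> mod_score P <= modularity.
Proof. by move=> hP; apply: le_bigmax_cond. Qed.

Lemma modularity_attained :
  exists2 P, finset.partition P [set: T] & modularity = mod_score P.
Proof.
rewrite /modularity; elim/big_ind: _.
- by exists singletons => //; exact: singletons_partition.
- move=> x y [P hP ->] [Q hQ ->].
  by case: (leP (mod_score P) (mod_score Q)) => _; [exists Q|exists P].
- by move=> P hP; exists P.
Qed.

End Graph.

Arguments mod_score {T} G {R} P.
Arguments modularity {T} G {R}.

(* The Erdos-Renyi random graph: each of the 2-subsets of the vertex set is an
   edge with probability p, independently. *)
Section Gnp.
Variables (R : realType) (T : finType).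

Definition pairs : {set {set T}} := [set e : {set T} | #|e| == 2%N].

Definition gnp_mass (p : R) (G : graph T) : R :=
  \prod_(e in pairs) (if e \in edges G then p else 1 - p).

Definition gnp_prob (p : R) (E : pred (graph T)) : R :=
  \sum_(G : graph T | E G) gnp_mass p G.

Lemma gnp_mass_ge0 p G : 0 <= p <= 1 -> 0 <= gnp_mass p G.
Proof.
case/andP=> p0 p1; apply: prodr_ge0 => e _.
by case: ifP; rewrite ?subr_ge0.
Qed.

Lemma gnp_probT p : gnp_prob p predT = 1.
Proof.
pose F (e : {set T}) : R := if e \in pairs then p else 0.
pose H (e : {set T}) : R := if e \in pairs then 1 - p else 1.
have : \prod_(e : {set T}) (F e + H e) = 1.
  by apply: big1 => e _; rewrite /F /H; case: ifP; rewrite ?add0r // addrC subrK.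
rewrite bigA_distr => <-.
have subE (E : {set {set T}}) :
    [forall e in E, #|e| == 2] = (E \subset pairs).
  by apply/forall_inP/fintype.subsetP => h e /h; rewrite inE.
rewrite (bigID (fun E : {set {set T}} => [forall e in E, #|e| == 2])) /=.
rewrite [X in _ + X]big1 ?addr0 => [|E]; last first.
  rewrite subE => /fintype.subsetPn[e eE enp].
  by rewrite (bigD1 e) //= eE /F (negbTE enp) mul0r.
rewrite /gnp_prob [RHS](reindex_omap (@edges T) insub) => [|E hE]; last first.
  by rewrite insubT.
apply: eq_big => [G|G _].
  by rewrite valK eqxx andbT; case: G.
rewrite /gnp_mass big_mkcond; apply: eq_bigr => e _ /=.
rewrite /F /H; case: ifP => [//|enp].
case: ifP => // eG; move: enp; rewrite inE.
by rewrite (card_edge eG) eqxx.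
Qed.

End Gnp.

Definition whp (R : realType) (p : nat -> R)
    (E : forall n : nat, pred (graph 'I_n)) : Prop :=
  ((fun n => gnp_prob (p n) (E n)) @ \oo --> (1 : R))%classic.

(* Main.v *)
(* The cluster of a set of root vertices is revealed by processing one active
   vertex at a time: its edges to the other unprocessed vertices are fresh, and
   what remains is the same problem on one vertex less.  Every probabilistic
   estimate is an induction on this recursion.

   Below the threshold, with eps = 1 - np, each edge found is charged as a new
   individual of a branching process.  This bounds the exponential moment of
   the number e of edges of the component of x, at parameter eps^2 / 2,
   weighted by deg x.  It follows that whp every component has
   e^2 <= 2 e(G); cutting a component then loses more edges than it gains in
   the degree tax, so the components partition is optimal.  Moreover
   1 - q_C = sum_C vol(C)^2 / (4 e(G)^2), and the numerator equals
   sum_x deg(x) vol(C(x)), whose mean is of order n^2 p / eps and whose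
   variance is at most the sum over x of E[deg(x) vol(C(x))^3], since the
   graph off C(x) is again a binomial random graph; Chebyshev concludes.

   For np in [1, 1 + eps], one representative of each component with at least
   K vertices gives at most n / K roots, whose joint cluster is the union of
   the large components.  The sets of n / K roots are so few that a union bound
   over them shows that this cluster has fewer than 2 eps n + 1 vertices and
   fewer than (2 eps - eps^2) np n edges; the small components contribute
   O(1 / n) to 1 - q_C. *)
From HB Require Import structures.
Require Import Defs.
From mathcomp Require Import all_boot all_order all_algebra.
From mathcomp Require Import zify ring lra.
Set Implicit Arguments.
Unset Strict Implicit.
Unset Printing Implicit Defensive.
Import Order.TTheory GRing.Theory Num.Theory.
Local Open Scope ring_scope.

(** * Expectation over a random subset *)

Section RandomSubset.
Variables (R : realFieldType) (p : R).

Definition Ex (U : finType) (A : {set U}) (F : {set U} -> R) : R :=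
  \sum_(B : {set U} | B \subset A) p ^+ #|B| * (1 - p) ^+ #|A :\: B| * F B.

Section Linear.
Variables (U : finType) (A : {set U}).
Implicit Types (F H : {set U} -> R) (B : {set U}).

Lemma eq_Ex F H : (forall B, B \subset A -> F B = H B) -> Ex A F = Ex A H.
Proof. by move=> FH; apply: eq_bigr => B BA; rewrite FH. Qed.

Lemma ExD F H : Ex A (fun B => F B + H B) = Ex A F + Ex A H.
Proof. by rewrite -big_split; apply: eq_bigr => B _; rewrite mulrDr. Qed.

Lemma ExZ c F : Ex A (fun B => c * F B) = c * Ex A F.
Proof. by rewrite /Ex mulr_sumr; apply: eq_bigr => B _; rewrite mulrCA. Qed.

Lemma ExB F H : Ex A (fun B => F B - H B) = Ex A F - Ex A H.
Proof.
rewrite ExD; congr (_ + _); rewrite -[RHS]mulN1r -ExZ.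
by apply: eq_Ex => B _; rewrite mulN1r.
Qed.

Lemma Ex_sum (I : finType) (P : pred I) (F : I -> {set U} -> R) :
  Ex A (fun B => \sum_(i | P i) F i B) = \sum_(i | P i) Ex A (F i).
Proof.
by rewrite /Ex exchange_big; apply: eq_bigr => B _; rewrite mulr_sumr.
Qed.

Hypothesis p01 : 0 <= p <= 1.

Lemma le_Ex F H : (forall B, B \subset A -> F B <= H B) -> Ex A F <= Ex A H.
Proof.
case/andP: p01 => p0 p1 FH; apply: ler_sum => B BA; apply: ler_wpM2l (FH B BA).
by rewrite mulr_ge0 ?exprn_ge0 ?subr_ge0.
Qed.

Lemma Ex_ge0 F : (forall B, B \subset A -> 0 <= F B) -> 0 <= Ex A F.
Proof.
case/andP: p01 => p0 p1 F0; apply: sumr_ge0 => B BA.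
by rewrite mulr_ge0 ?F0 // mulr_ge0 ?exprn_ge0 ?subr_ge0.
Qed.

End Linear.

Lemma Ex0 (U : finType) (F : {set U} -> R) : Ex set0 F = F set0.
Proof.
rewrite /Ex (big_pred1 set0) => [|B]; last by rewrite subset0.
by rewrite setD0 cards0 !expr0 !mul1r.
Qed.

Lemma Ex1 (U : finType) (a : U) (F : {set U} -> R) :
  Ex [set a] F = p * F [set a] + (1 - p) * F set0.
Proof.
rewrite /Ex (bigD1 [set a]) //= (big_pred1 set0) => [|B].
  by rewrite setDv setD0 !cards0 !cards1 !expr1 !expr0 mulr1 mul1r.
rewrite subset1; case: (eqVneq B [set a]) => [->|_] /=; last by rewrite andbT.
by apply/esym/negbTE/set0Pn; exists a; rewrite set11.
Qed.

Lemma ExU (U : finType) (A1 A2 : {set U}) (F : {set U} -> R) :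
  [disjoint A1 & A2] ->
  Ex (A1 :|: A2) F = Ex A1 (fun B1 => Ex A2 (fun B2 => F (B1 :|: B2))).
Proof.
move=> dA; rewrite /Ex.
under [RHS]eq_bigr do rewrite mulr_sumr.
rewrite pair_big /=.
rewrite (reindex_onto (fun B : {set U} * {set U} => B.1 :|: B.2)
   (fun B => (B :&: A1, B :&: A2))) /=; last first.
  by move=> B /setIidPl; rewrite setIUr.
have dB (B1 B2 : {set U}) : B1 \subset A1 -> B2 \subset A2 ->
    ((B1 :|: B2) :&: A1 = B1) * ((B1 :|: B2) :&: A2 = B2).
  move=> s1 s2; rewrite !setIUl (setIidPl s1) (setIidPl s2).
  have /disjoint_setI0 -> : [disjoint B2 & A1].
    by rewrite disjoint_sym (disjointWr s2).
  have /disjoint_setI0 -> : [disjoint B1 & A2] by rewrite (disjointWl s1).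
  by rewrite setU0 set0U.
have cU (B1 B2 : {set U}) : B1 \subset A1 -> B2 \subset A2 ->
    #|B1 :|: B2| = (#|B1| + #|B2|)%N.
  move=> s1 s2; rewrite cardsU disjoint_setI0 ?cards0 ?subn0 //.
  by rewrite (disjointWl s1) // (disjointWr s2).
apply: eq_big => [[B1 B2] /=|[B1 B2] /= /andP[sU /eqP[e1 e2]]].
  apply/andP/andP => [[_ /eqP[<- <-]]|[s1 s2]]; first by rewrite !subsetIr.
  by rewrite setUSS // !dB.
have s1 : B1 \subset A1 by rewrite -e1 subsetIr.
have s2 : B2 \subset A2 by rewrite -e2 subsetIr.
rewrite cU // !cardsDS // !cU //.
have -> : (#|A1| + #|A2| - (#|B1| + #|B2|) =
           #|A1| - #|B1| + (#|A2| - #|B2|))%N.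
  by move: (subset_leq_card s1) (subset_leq_card s2); lia.
by rewrite !exprD; ring.
Qed.

Lemma ExU1 (U : finType) (a : U) (A : {set U}) (F : {set U} -> R) : a \notin A ->
  Ex (a |: A) F = p * Ex A (fun B => F (a |: B)) + (1 - p) * Ex A F.
Proof.
move=> aA; rewrite ExU ?disjoints1 // Ex1.
by congr (_ + _ * _); apply: eq_Ex => B _; rewrite set0U.
Qed.

Lemma Ex_pow2 (U : finType) (A : {set U}) x y :
  Ex A (fun B => x ^+ #|B| * y ^+ #|A :\: B|) = (p * x + (1 - p) * y) ^+ #|A|.
Proof.
move cA: #|A| => n; elim: n A cA => [|n IH] A cA.
  by rewrite (cards0_eq cA) Ex0 setD0 cards0 !expr0 mulr1.
have /card_gt0P[a aA'] : (0 < #|A|)%N by rewrite cA.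
have aA : a \notin A :\ a by rewrite setD11.
have {}cA : #|A :\ a| = n by move: cA; rewrite (cardsD1 a) aA' => -[].
rewrite -(setD1K aA'); move: (A :\ a) aA cA => {aA'}A aA cA.
have aB (B : {set U}) : B \subset A -> a \notin B by move=> BA; apply: contra aA; apply/subsetP.
rewrite ExU1 // exprS -(IH A cA) [RHS]mulrDl -[p * x * _]mulrA -[_ * y * _]mulrA -[x * _]ExZ
  -[y * _]ExZ.
congr (_ * _ + _ * _); apply: eq_Ex => B BA.
  rewrite (cardsDS BA) (cardsDS (setUS _ BA)) !cardsU1 aA (aB B) // !add1n.
  by rewrite subSS exprS mulrA.
rewrite (cardsDS BA) (cardsDS (subset_trans BA (subsetUr _ _))) cardsU1 aA.
by rewrite add1n subSn ?subset_leq_card // exprS mulrCA.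
Qed.

Lemma Ex_pow (U : finType) (A : {set U}) w :
  Ex A (fun B => w ^+ #|B|) = (1 + p * (w - 1)) ^+ #|A|.
Proof.
have -> : 1 + p * (w - 1) = p * w + (1 - p) * 1 by ring.
by rewrite -Ex_pow2; apply: eq_Ex => B _; rewrite expr1n mulr1.
Qed.

Lemma Ex_cst (U : finType) (A : {set U}) c : Ex A (fun=> c) = c.
Proof.
have := Ex_pow A 1; rewrite subrr mulr0 addr0 expr1n => E.
rewrite -[RHS]mulr1 -E -ExZ; apply: eq_Ex => B _; by rewrite expr1n mulr1.
Qed.

Lemma Ex_imset (U V : finType) (f : U -> V) (A : {set U}) (F : {set V} -> R) :
  injective f -> Ex (f @: A) F = Ex A (fun B => F (f @: B)).
Proof.
move=> fI; rewrite /Ex (reindex_onto (fun B : {set U} => f @: B)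
   (fun B => f @^-1: B)) /=; last first.
  move=> B BA; apply/setP => y; apply/imsetP/idP => [[x + ->]|yB].
    by rewrite inE.
  by have /imsetP[x xA e] := subsetP BA y yB; exists x; rewrite // inE -e.
have fS (B : {set U}) : (f @: B \subset f @: A) = (B \subset A).
  apply/idP/idP => [/subsetP s|]; last exact: imsetS.
  by apply/subsetP => x xB; have := s (f x); rewrite !mem_imset // => ->.
apply: eq_big => [B|B /andP[BA _]]; last first.
  by rewrite !cardsDS -?fS // !card_imset.
rewrite fS; have -> : f @^-1: (f @: B) = B; last by rewrite eqxx andbT.
by apply/setP => x; rewrite inE mem_imset.
Qed.

Lemma Ex_palm (U : finType) (A : {set U}) (F : {set U} -> R) :
  Ex A (fun B => #|B|%:R * F B) =
  p * \sum_(a in A) Ex (A :\ a) (fun B => F (a |: B)).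
Proof.
transitivity (Ex A (fun B => \sum_(a in A) (a \in B)%:R * F B)).
  apply: eq_Ex => B BA; rewrite -mulr_suml -natr_sum; congr (_%:R * _).
  rewrite -sum1_card big_mkcond [RHS]big_mkcond; apply: eq_bigr => a _.
  by case: (boolP (a \in B)) => [aB|_]; [rewrite (subsetP BA)|case: ifP].
rewrite Ex_sum mulr_sumr; apply: eq_bigr => a aA.
rewrite -{1}(setD1K aA) ExU1; last by rewrite setD11.
rewrite [X in _ + _ * X](_ : _ = 0) ?mulr0 ?addr0; last first.
  rewrite -(Ex_cst (A :\ a) 0); apply: eq_Ex => B BA.
  have -> : a \in B = false by apply/negP => /(subsetP BA); rewrite !inE eqxx.
  by rewrite mul0r.
by congr (_ * _); apply: eq_Ex => B _; rewrite setU11 mul1r.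
Qed.

End RandomSubset.

(** * Exploring the cluster of a set of roots *)

Section Reach.
Variable T : finType.
Implicit Types (E : {set {set T}}) (S Rt N W : {set T}) (x y v : T).

Definition link E S : rel T := [rel x y | [&& x \in S, y \in S & [set x; y] \in E]].

Definition reach E S Rt : {set T} :=
  [set y | [exists r in Rt, connect (link E S) r y]].

Definition pairs_in S : {set {set T}} := [set e : {set T} | (#|e| == 2) && (e \subset S)].

Definition star v N : {set {set T}} := (fun y => [set v; y]) @: N.

Definition edges_within E W : nat := #|[set e in E | e \subset W]|.

Lemma linkE E S x y :
  link E S x y = [&& x \in S, y \in S & [set x; y] \in E].
Proof. by []. Qed.

Lemma reachP E S Rt y :
  reflect (exists2 r, r \in Rt & connect (link E S) r y) (y \in reach E S Rt).
Proof. by rewrite inE; exact: exists_inP. Qed.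

Lemma reach_roots E S Rt : Rt \subset reach E S Rt.
Proof. by apply/subsetP => x xR; apply/reachP; exists x => //; exact: connect0. Qed.

Lemma reach_set0 E S : reach E S set0 = set0.
Proof. by apply/setP => y; rewrite inE [RHS]inE; apply/exists_inP => -[r]; rewrite inE. Qed.

Lemma reach_step E S Rt x y : x \in reach E S Rt -> link E S x y -> y \in reach E S Rt.
Proof.
move=> /reachP[r rR rx] xy; apply/reachP; exists r => //.
exact: connect_trans rx (connect1 xy).
Qed.

Lemma reach_min E S Rt W : Rt \subset W ->
  (forall x y, x \in W -> link E S x y -> y \in W) -> reach E S Rt \subset W.
Proof.
move=> RW cW; apply/subsetP => y /reachP[r /(subsetP RW) rW /connectP[q]].
elim: q r rW => [|z q IH] r rW /=; first by move=> _ ->.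
by case/andP=> /(cW _ _ rW) zW; exact: IH.
Qed.

Lemma reach_sub E S Rt : Rt \subset S -> reach E S Rt \subset S.
Proof. by move=> RS; apply: reach_min => // x y _ /and3P[]. Qed.

Lemma set2_inj v : injective (fun y => [set v; y]).
Proof.
move=> y z /setP e; have := e y; have := e z; rewrite !inE !eqxx !orbT.
by case: (eqVneq z v) => [-> /= _ /esym/orP[]/eqP ->|_ /= /eqP ->].
Qed.

Lemma in_star v N y : ([set v; y] \in star v N) = (y \in N).
Proof. exact: (mem_imset _ _ (@set2_inj v)). Qed.

Lemma mem_star v N (e : {set T}) : e \in star v N -> v \in e.
Proof. by case/imsetP=> y _ ->; rewrite !inE eqxx. Qed.

Lemma card_star v N : #|star v N| = #|N|.
Proof. by rewrite card_imset //; exact: set2_inj. Qed.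

Lemma pairs_inD1 S v : v \in S -> pairs_in S = star v (S :\ v) :|: pairs_in (S :\ v).
Proof.
move=> vS; apply/setP => e; rewrite !inE; case: (boolP (v \in e)) => ve; last first.
  rewrite subsetD1 ve andbT; case: (boolP (e \in _)) => [/mem_star|_] //.
  by rewrite (negbTE ve).
rewrite subsetD1 ve !andbF orbF; apply/andP/imsetP => [[/cards2P[x [y [xy ee]]] eS]|].
  move: ve eS; rewrite {}ee !inE => /orP[]/eqP-> eS; last rewrite setUC.
    by exists y => //; rewrite !inE eq_sym xy (subsetP eS) // !inE eqxx orbT.
  by exists x => //; rewrite !inE xy (subsetP eS) // !inE eqxx.
case=> y; rewrite !inE => /andP[yv yS] ->; rewrite cards2 [v == y]eq_sym yv; split=> //.
by apply/subsetP => z; rewrite !inE => /orP[]/eqP->.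
Qed.

Lemma disjoint_star S v N E : E \subset pairs_in (S :\ v) -> [disjoint star v N & E].
Proof.
move=> ES; rewrite disjoints_subset; apply/subsetP => e /mem_star ve.
rewrite inE; apply/negP => /(subsetP ES); rewrite inE => /andP[_ /subsetP/(_ v ve)].
by rewrite !inE eqxx.
Qed.

Section Step.
Variables (S Rt : {set T}) (v : T) (N : {set T}) (E : {set {set T}}).
Hypotheses (RS : Rt \subset S) (vS : v \in S).
Hypotheses (NS : N \subset S :\ v) (ES : E \subset pairs_in (S :\ v)).

Let notinE y : [set v; y] \notin E.
Proof.
apply/negP => /(subsetP ES); rewrite inE => /andP[_ /subsetP/(_ v)].
by rewrite !inE !eqxx => /(_ isT).
Qed.

Lemma nbrs_explore : [set y in S :\ v | [set v; y] \in star v N :|: E] = N.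
Proof.
apply/setP => y; rewrite inE [_ \in star v N :|: E]inE in_star (negbTE (notinE y)) orbF.
by case: (boolP (y \in N)) => [/(subsetP NS)->|]; rewrite ?andbF.
Qed.

Let Rt' := (Rt :\ v) :|: N.

Lemma roots_explore : Rt' \subset S :\ v.
Proof. by rewrite subUset NS setSD. Qed.

Lemma reach_explore : v \in Rt ->
  reach (star v N :|: E) S Rt = v |: reach E (S :\ v) Rt'.
Proof.
move=> vR; apply/eqP; rewrite eqEsubset; apply/andP; split.
  apply: reach_min => [|x y].
    apply/subsetP => x xR; rewrite in_setU1.
    case: eqVneq => //= xv; apply: (subsetP (reach_roots _ _ _)).
    by rewrite !inE xv xR.
  rewrite !in_setU1 => xW /and3P[xS yS].
  case: (eqVneq y v) => //= yv; case: (eqVneq x v) xW => [-> _|xv /= xW].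
    rewrite in_setU in_star (negbTE (notinE y)) orbF => yN.
    by apply: (subsetP (reach_roots _ _ _)); rewrite !inE yN orbT.
  rewrite in_setU => /orP[/mem_star|xyE].
    by rewrite in_set2 ![v == _]eq_sym (negbTE xv) (negbTE yv).
  by apply: reach_step xW _; rewrite linkE !in_setD1 xv xS yv yS.
rewrite subUset sub1set (subsetP (reach_roots _ _ _)) //=.
apply: reach_min => [|x y xW /and3P[]]; last first.
  rewrite !in_setD1 => /andP[_ xS] /andP[_ yS] xyE.
  by apply: reach_step xW _; rewrite linkE xS yS in_setU xyE orbT.
rewrite subUset; apply/andP; split.
  apply: subset_trans (reach_roots _ _ _); exact: subsetDl.
apply/subsetP => y yN; apply: (@reach_step _ _ _ v).
  exact: subsetP (reach_roots _ _ _) _ vR.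
have := subsetP NS _ yN; rewrite !inE => /andP[_ yS].
by rewrite linkE vS yS in_setU in_star yN.
Qed.

Lemma card_reach_explore : v \in Rt ->
  #|reach (star v N :|: E) S Rt| = #|reach E (S :\ v) Rt'|.+1.
Proof.
move=> vR; rewrite reach_explore // cardsU1.
suff -> : v \notin reach E (S :\ v) Rt' by [].
apply/negP => /(subsetP (reach_sub _ roots_explore)).
by rewrite !inE eqxx.
Qed.

Lemma edges_explore : v \in Rt ->
  edges_within (star v N :|: E) (reach (star v N :|: E) S Rt) =
  (#|N| + edges_within E (reach E (S :\ v) Rt'))%N.
Proof.
move=> vR; rewrite reach_explore //; set W := reach _ _ _.
rewrite -(card_star v N) /edges_within.
rewrite (_ : [set e in _ | _] = star v N :|: [set e in E | e \subset W]); last first.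
  apply/setP => e; rewrite !inE; case: (boolP (e \in star v N)) => [|eN] /=.
    case/imsetP => y yN ->; rewrite subUset !sub1set !inE eqxx /=.
    have : y \in W by apply: (subsetP (reach_roots _ _ _)); rewrite !inE yN orbT.
    by rewrite inE => ->; rewrite orbT.
  case: (boolP (e \in E)) => //= /(subsetP ES); rewrite inE subsetD1.
  by case/and3P=> _ _ ve; rewrite -subDset (setDidPl _) // disjoint_sym disjoints1.
rewrite cardsU disjoint_setI0 ?cards0 ?subn0 //.
apply: (@disjoint_star S); apply: subset_trans ES.
by apply/subsetP => e; rewrite inE => /andP[].
Qed.

End Step.

Section Expectation.
Variables (R : realFieldType) (p : R).

Lemma Ex_star S v (F : {set {set T}} -> R) : v \in S ->
  Ex p (pairs_in S) F =
  Ex p (S :\ v) (fun N => Ex p (pairs_in (S :\ v)) (fun E => F (star v N :|: E))).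
Proof.
move=> vS; rewrite (pairs_inD1 vS) ExU; last exact: disjoint_star.
by rewrite Ex_imset //; exact: set2_inj.
Qed.

Lemma Ex_explore S Rt v (F : {set T} -> nat -> nat -> R) :
  v \in Rt -> Rt \subset S ->
  Ex p (pairs_in S) (fun E => F [set y in S :\ v | [set v; y] \in E]
    #|reach E S Rt| (edges_within E (reach E S Rt))) =
  Ex p (S :\ v) (fun N => Ex p (pairs_in (S :\ v)) (fun E =>
    F N #|reach E (S :\ v) (Rt :\ v :|: N)|.+1
      (#|N| + edges_within E (reach E (S :\ v) (Rt :\ v :|: N))))).
Proof.
move=> vR RS; have vS := subsetP RS v vR; rewrite (Ex_star _ vS).
apply: eq_Ex => N NS; apply: eq_Ex => E ES.
by rewrite (nbrs_explore NS ES) card_reach_explore // edges_explore.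
Qed.

End Expectation.
End Reach.

Section ReachInduction.
Variable T : finType.
Implicit Types (E : {set {set T}}) (S Rt N U : {set T}) (x y v : T).

Lemma star_decomp S v E : v \in S -> E \subset pairs_in S ->
  exists N E', [/\ N \subset S :\ v, E' \subset pairs_in (S :\ v) & E = star v N :|: E'].
Proof.
move=> vS ES; exists [set y in S :\ v | [set v; y] \in E], (E :&: pairs_in (S :\ v)).
split; [by apply/subsetP => y; rewrite inE => /andP[]|exact: subsetIr|].
apply/setP => e; rewrite in_setU in_setI; apply/idP/orP => [eE|[/imsetP[y]|/andP[]//]].
  have := subsetP ES _ eE; rewrite (pairs_inD1 vS) in_setU => /orP[]; last by right; rewrite eE.
  by case/imsetP => y yS ee; left; rewrite ee in_star inE yS -ee.
by rewrite inE => /andP[_ yE] ->.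
Qed.

Lemma explore_ind (P : {set T} -> {set T} -> Prop) :
  (forall S, P S set0) ->
  (forall S Rt v, v \in Rt -> Rt \subset S ->
    (forall N, N \subset S :\ v -> P (S :\ v) (Rt :\ v :|: N)) -> P S Rt) ->
  forall S Rt, Rt \subset S -> P S Rt.
Proof.
move=> P0 PS S Rt; move cS: #|S| => k; elim: k S Rt cS => [|k IH] S Rt cS RS.
  have -> : Rt = set0 by apply/eqP; rewrite -subset0 -(cards0_eq cS).
  exact: P0.
have [->|/set0Pn[v vR]] := eqVneq Rt set0; first exact: P0.
apply: (PS _ _ v) => // N NS; apply: IH; last exact: roots_explore.
by move: cS; rewrite (cardsD1 v) (subsetP RS) // => -[].
Qed.

Lemma card_reach_le E S Rt : E \subset pairs_in S -> Rt \subset S ->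
  (#|reach E S Rt| <= #|Rt| + edges_within E (reach E S Rt))%N.
Proof.
move=> + RS; elim/explore_ind: RS E => {S Rt} [S|S Rt v vR RS IH] E ES.
  by rewrite reach_set0 cards0.
have [N [E' [NS E'S ->]]] := star_decomp (subsetP RS v vR) ES.
rewrite card_reach_explore ?edges_explore ?(subsetP RS v vR) //.
have := IH N NS E' E'S; have := leq_of_leqif (leq_card_setU (Rt :\ v) N).
by move: (cardsD1 v Rt); rewrite vR /=; lia.
Qed.

Lemma edges_within_set0 E S : E \subset pairs_in S -> edges_within E set0 = 0%N.
Proof.
move=> ES; apply/eqP; rewrite cards_eq0; apply/eqP/setP => e; rewrite !inE.
apply/negP => /andP[/(subsetP ES)]; rewrite inE => /andP[+ _].
by rewrite subset0 => + /eqP e0; rewrite e0 cards0.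
Qed.

End ReachInduction.

Section Exploration.
Variables (T : finType) (R : realFieldType) (p : R).
Hypothesis p01 : 0 <= p <= 1.
Implicit Types (E : {set {set T}}) (S Rt N U : {set T}) (x y v : T).

(* An edge to an already active vertex is charged as a new individual, so the
   number of edges is dominated by the total progeny of a Bin(n, p) branching
   process; G is a supersolution of its generating function equation. *)
Lemma Ex_edges_le z G n S Rt : 1 <= z -> 1 <= G ->
  (1 + p * (z * G - 1)) ^+ n <= G -> (#|S| <= n.+1)%N -> Rt \subset S ->
  Ex p (pairs_in S) (fun E => z ^+ edges_within E (reach E S Rt)) <= G ^+ #|Rt|.
Proof.
case/andP: (p01) => p0 p1 z1 G1 hG + RS.
have z0 : 0 <= z by lra.
elim/explore_ind: RS => {S Rt} [S _|S Rt v vR RS IH Sn].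
  rewrite cards0 expr0 -[leRHS](Ex_cst p (pairs_in S)).
  apply: le_Ex => // E ES; by rewrite reach_set0 (edges_within_set0 ES).
rewrite (Ex_explore p (fun _ _ e => z ^+ e) vR RS).
have vS := subsetP RS v vR.
have Sv : #|S| = #|S :\ v|.+1 by rewrite (cardsD1 v S) vS.
have Rv : #|Rt| = #|Rt :\ v|.+1 by rewrite (cardsD1 v Rt) vR.
apply: (@le_trans _ _ (Ex p (S :\ v) (fun N => G ^+ #|Rt :\ v| * (z * G) ^+ #|N|))).
  apply: le_Ex => // N NS; under eq_Ex do rewrite exprD.
  rewrite ExZ exprMn mulrCA; apply: ler_wpM2l; first by rewrite exprn_ge0.
  apply: le_trans (IH N NS _) _; first by rewrite -ltnS -Sv ltnW.
  rewrite -exprD ler_weXn2l // -?Rv.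
  exact: leq_of_leqif (leq_card_setU _ _).
rewrite ExZ Ex_pow Rv exprSr; apply: ler_wpM2l; first by rewrite exprn_ge0 //; lra.
apply: le_trans _ hG; apply: ler_weXn2l; last by rewrite -ltnS -Sv.
by rewrite lerDl mulr_ge0 // subr_ge0 mulr_ege1.
Qed.


Definition nbr E S v : {set T} := [set y in S :\ v | [set v; y] \in E].

Lemma Ex_nbr S v (F : {set T} -> R) : v \in S ->
  Ex p (pairs_in S) (fun E => F (nbr E S v)) = Ex p (S :\ v) F.
Proof.
move=> vS; rewrite (Ex_star _ _ vS); apply: eq_Ex => N NS.
rewrite -[RHS](Ex_cst p (pairs_in (S :\ v))); apply: eq_Ex => E ES.
by rewrite /nbr (nbrs_explore NS ES).
Qed.

Lemma Ex_card (U : finType) (A : {set U}) : Ex p A (fun B => #|B|%:R) = p * #|A|%:R.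
Proof.
transitivity (Ex p A (fun B => #|B|%:R * 1)).
  by apply: eq_Ex => B _; rewrite mulr1.
rewrite Ex_palm; congr (_ * _).
by under eq_bigr do rewrite Ex_cst; rewrite sumr_const.
Qed.

Lemma Ex_card_pow (U : finType) (A : {set U}) w :
  Ex p A (fun B => #|B|%:R * w ^+ #|B|) =
  p * #|A|%:R * (w * (1 + p * (w - 1)) ^+ #|A|.-1).
Proof.
rewrite Ex_palm -mulrA mulr_natl -sumr_const; congr (_ * _).
apply: eq_bigr => a aA; rewrite (cardsD1 a A) aA add1n /= -Ex_pow -ExZ.
apply: eq_Ex => B BA; rewrite cardsU1 -exprS.
suff -> : a \notin B by [].
by apply/negP => /(subsetP BA); rewrite setD11.
Qed.

Lemma Ex_deg_edges_le z G n S x : 1 <= z -> 1 <= G ->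
  (1 + p * (z * G - 1)) ^+ n <= G -> (#|S| <= n.+1)%N -> x \in S ->
  Ex p (pairs_in S) (fun E => #|nbr E S x|%:R *
     (z ^+ edges_within E (reach E S [set x]) - 1)) <=
  p * #|S :\ x|%:R * (z * G * G - 1).
Proof.
case/andP: (p01) => p0 p1 z1 G1 hG Sn xS.
have Sx : #|S| = #|S :\ x|.+1 by rewrite (cardsD1 x S) xS.
under eq_Ex do rewrite mulrBr mulr1.
rewrite ExB (Ex_nbr (fun N => #|N|%:R) xS) Ex_card [leRHS]mulrBr mulr1 lerB //.
rewrite (Ex_explore p (fun N _ e => #|N|%:R * z ^+ e) (set11 x)) ?sub1set //.
rewrite setDv; apply: (@le_trans _ _ (Ex p (S :\ x) (fun N => #|N|%:R * (z * G) ^+ #|N|))).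
  apply: le_Ex => // N NS; under eq_Ex do rewrite exprD mulrA.
  rewrite ExZ exprMn mulrA; apply: ler_wpM2l.
    by rewrite mulr_ge0 // exprn_ge0 //; lra.
  by rewrite set0U; apply: Ex_edges_le hG _ NS => //; rewrite -ltnS -Sx ltnW.
rewrite Ex_card_pow; apply: ler_wpM2l; first by rewrite mulr_ge0.
apply: ler_wpM2l; first by rewrite mulr_ge0; lra.
apply: le_trans _ hG; apply: ler_weXn2l; last first.
  by rewrite (leq_trans (leq_pred _)) // -ltnS -Sx.
by rewrite lerDl mulr_ge0 // subr_ge0 mulr_ege1.
Qed.

Lemma card_roots_explore S Rt v N : N \subset S :\ v ->
  #|Rt :\ v :|: N| = (#|Rt :\ v| + #|N :\: Rt|)%N.
Proof.
move=> NS; have -> : Rt :\ v :|: N = Rt :\ v :|: (N :\: Rt).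
  apply/setP => y; rewrite !inE; case: (boolP (y \in N)) => [/(subsetP NS)|_] /=.
    by rewrite !inE => /andP[-> _]; case: (y \in Rt).
  by rewrite andbF.
rewrite cardsU disjoint_setI0 ?cards0 ?subn0 // disjoint_sym.
by rewrite disjoints_subset; apply/subsetP => y; rewrite !inE negb_and => /andP[-> _]; rewrite orbT.
Qed.

Lemma Ex_new S Rt v (F : {set T} -> R) : v \in Rt -> Rt \subset S ->
  Ex p (S :\ v) (fun N => F (N :\: Rt)) = Ex p (S :\: Rt) F.
Proof.
move=> vR RS; have -> : S :\ v = (Rt :\ v) :|: (S :\: Rt).
  apply/setP => y; rewrite !inE; case: eqVneq => [->|_]; first by rewrite vR.
  by case: (boolP (y \in Rt)) => [/(subsetP RS)->|].
rewrite ExU; last first.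
  by rewrite disjoints_subset; apply/subsetP => y; rewrite !inE => /andP[_ ->].
rewrite -[RHS](Ex_cst p (Rt :\ v)); apply: eq_Ex => N1 N1R; apply: eq_Ex => N2 N2R.
congr F; apply/setP => y; rewrite !inE.
case: (boolP (y \in N2)) => [/(subsetP N2R)|_]; first by rewrite inE orbT andbT => /andP[].
rewrite orbF andbC; apply/negP => /andP[/(subsetP N1R)].
by rewrite inE => /andP[_ ->].
Qed.

(* A vertex is found within the first j steps with probability 1 - (1 - p)^j,
   so j steps need a Bin(|S \ Rt|, 1 - (1 - p)^j) variable of size j - |Rt|. *)
Lemma Ex_reach_tail th S Rt j : 1 <= th -> Rt \subset S ->
  th ^+ j * Ex p (pairs_in S) (fun E => (j <= #|reach E S Rt|)%N%:R) <=
  th ^+ #|Rt| * (1 + (th - 1) * (1 - (1 - p) ^+ j)) ^+ #|S :\: Rt|.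
Proof.
case/andP: (p01) => p0 p1 th1 RS.
have q0 i : 0 <= 1 - (1 - p) ^+ i by rewrite subr_ge0 exprn_ile1 //; lra.
have th0 : 0 <= th by lra.
elim/explore_ind: RS j => {S Rt} [S|S Rt v vR RS IH] [|j].
- rewrite expr0 mul1r cards0 expr0 mul1r subrr mulr0 addr0 expr1n.
  by under eq_Ex do rewrite leq0n; rewrite Ex_cst.
- under eq_Ex do rewrite reach_set0 cards0 ltn0.
  rewrite Ex_cst mulr0 cards0 expr0 mul1r exprn_ge0 //.
  by rewrite addr_ge0 // mulr_ge0 //; lra.
- rewrite expr0 mul1r subrr mulr0 addr0 expr1n mulr1.
  by under eq_Ex do rewrite leq0n; rewrite Ex_cst exprn_ege1.
rewrite (Ex_explore p (fun _ t _ => (j < t)%N%:R) vR RS).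
have Rv : #|Rt| = #|Rt :\ v|.+1 by rewrite (cardsD1 v Rt) vR.
rewrite Rv exprS [th ^+ #|Rt :\ v|.+1]exprS -!mulrA ler_wpM2l //.
set a := 1 + (th - 1) * (1 - (1 - p) ^+ j).
rewrite -ExZ; apply: (@le_trans _ _ (Ex p (S :\ v) (fun N =>
  th ^+ #|Rt :\ v| * (th ^+ #|N :\: Rt| * a ^+ #|(S :\: Rt) :\: N|)))).
  apply: le_Ex => // N NS; apply: le_trans (IH N NS j) _.
  rewrite mulrA -exprD -/a (card_roots_explore Rt NS).
  suff -> : (S :\ v) :\: (Rt :\ v :|: N) = (S :\: Rt) :\: N by [].
  apply/setP => y; rewrite !inE; case: eqVneq => [->|_] /=.
    by rewrite vR !andbF.
  by rewrite negb_or andbA [(_ \notin N) && _]andbC.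
rewrite ExZ ler_wpM2l ?exprn_ge0 //.
have -> : 1 + (th - 1) * (1 - (1 - p) ^+ j.+1) = p * th + (1 - p) * a.
  by rewrite /a exprS; ring.
rewrite -Ex_pow2 -(Ex_new _ vR RS); apply: le_Ex => // N NS.
suff -> : (S :\: Rt) :\: (N :\: Rt) = (S :\: Rt) :\: N by [].
apply/setP => y; rewrite !inE; case: (y \in Rt); by rewrite ?andbF.
Qed.

Lemma Ex_edges_tail th S Rt j : 1 <= th -> Rt \subset S ->
  Ex p (pairs_in S) (fun E =>
    (#|reach E S Rt| <= j)%N%:R * th ^+ edges_within E (reach E S Rt)) <=
  (1 + p * (th - 1)) ^+ (\sum_(i < j) (#|S|.-1 - i)).
Proof.
case/andP: (p01) => p0 p1 th1 RS.
have th0 : 0 <= th by lra.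
have w1 : 1 <= 1 + p * (th - 1) by rewrite lerDl mulr_ge0 //; lra.
elim/explore_ind: RS j => {S Rt} [S|S Rt v vR RS IH] j.
  apply: (@le_trans _ _ 1); last by rewrite exprn_ege1.
  rewrite -[leRHS](Ex_cst p (pairs_in S)); apply: le_Ex => // E ES.
  by rewrite reach_set0 (edges_within_set0 ES) cards0 mul1r.
rewrite (Ex_explore p (fun _ t e => (t <= j)%N%:R * th ^+ e) vR RS).
case: j => [|j].
  rewrite big_ord0 expr0 -[leRHS](Ex_cst p (S :\ v)); apply: le_Ex => // N _.
  rewrite -[leRHS](Ex_cst p (pairs_in (S :\ v))); apply: le_Ex => // E ES.
  by rewrite ltn0 mul0r.
have Sv : #|S| = #|S :\ v|.+1 by rewrite (cardsD1 v S) (subsetP RS v vR).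
rewrite big_ord_recl subn0 exprD Sv /= -Ex_pow mulrC -ExZ.
apply: le_Ex => // N NS; under eq_Ex do rewrite exprD mulrCA.
rewrite ExZ [leRHS]mulrC ler_wpM2l ?exprn_ge0 //.
apply: le_trans (IH N NS j) _; rewrite ler_weXn2l //.
by apply: leq_sum => i _; rewrite /bump /=; lia.
Qed.

(* Each of the t vertices reached has, when processed, at least |S| - t
   unreached vertices to connect to. *)
Lemma Ex_card_reach_ge S Rt : Rt \subset S ->
  #|Rt|%:R + p * Ex p (pairs_in S) (fun E =>
     #|reach E S Rt|%:R * (#|S|%:R - #|reach E S Rt|%:R)) <=
  Ex p (pairs_in S) (fun E => #|reach E S Rt|%:R).
Proof.
case/andP: (p01) => p0 p1.
elim/explore_ind => {S Rt} [S|S Rt v vR RS IH].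
  rewrite cards0 add0r -ExZ; apply: le_Ex => // E ES.
  by rewrite reach_set0 cards0 mul0r mulr0.
rewrite (Ex_explore p (fun _ t _ => t%:R) vR RS).
rewrite (Ex_explore p (fun _ t _ => t%:R * (#|S|%:R - t%:R)) vR RS).
have Sv : #|S| = #|S :\ v|.+1 by rewrite (cardsD1 v S) (subsetP RS v vR).
have Rv : #|Rt| = #|Rt :\ v|.+1 by rewrite (cardsD1 v Rt) vR.
have e1 : Ex p (S :\ v) (fun N => #|N :\: Rt|%:R) = p * #|S :\: Rt|%:R.
  by rewrite (Ex_new (fun B => #|B|%:R) vR RS) Ex_card.
apply: (@le_trans _ _ (Ex p (S :\ v) (fun N => 1 + (#|Rt :\ v :|: N|%:R +
  p * Ex p (pairs_in (S :\ v)) (fun E =>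
     #|reach E (S :\ v) (Rt :\ v :|: N)|%:R *
     (#|S :\ v|%:R - #|reach E (S :\ v) (Rt :\ v :|: N)|%:R)))))); last first.
  apply: le_Ex => // N NS; under [leRHS]eq_Ex do rewrite -add1n natrD.
  by rewrite ExD Ex_cst lerD2l; exact: IH.
pose Q N : R := Ex p (pairs_in (S :\ v)) (fun E =>
     #|reach E (S :\ v) (Rt :\ v :|: N)|%:R *
     (#|S :\ v|%:R - #|reach E (S :\ v) (Rt :\ v :|: N)|%:R)).
apply: (@le_trans _ _ (#|Rt|%:R + p * Ex p (S :\ v) (fun N => Q N + #|S :\: Rt|%:R))).
  rewrite lerD2l ler_wpM2l //; apply: le_Ex => // N NS.
  rewrite -[#|S :\: Rt|%:R](Ex_cst p (pairs_in (S :\ v))) -ExD.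
  apply: le_Ex => // E ES; set t := #|reach _ _ _|.
  rewrite Sv -!natr1 opprD addrACA subrr addr0 mulrDl mul1r lerD2l lerBlDr -natrD ler_nat.
  have Rt_t : (#|Rt :\ v| <= t)%N.
    apply: subset_leq_card; apply: subset_trans (reach_roots _ _ _).
    exact: subsetUl.
  by have := cardsDS RS; have := subset_leq_card RS; lia.
have -> : Ex p (S :\ v) (fun N => 1 + (#|Rt :\ v :|: N|%:R + p * Q N)) =
   Ex p (S :\ v) (fun N => 1 + #|Rt :\ v|%:R + (#|N :\: Rt|%:R + p * Q N)).
  by apply: eq_Ex => N NS; rewrite (card_roots_explore Rt NS) natrD !addrA.
by rewrite ExD Ex_cst !ExD !Ex_cst ExZ e1 Rv -natr1; lra.
Qed.

Lemma unexplored_pairs S v N E W :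
  (star v N :|: E) :&: pairs_in ((S :\ v) :\: W) = E :&: pairs_in ((S :\ v) :\: W).
Proof.
apply/setP => e; rewrite in_setI in_setU [RHS]in_setI.
case: (boolP (e \in star v N)) => //= /mem_star ve.
have -> : e \in pairs_in ((S :\ v) :\: W) = false; last by rewrite !andbF.
rewrite inE; apply/negP => /andP[_ /subsetP/(_ v ve)].
by rewrite !in_setD set11 andbF.
Qed.

(* The restriction of E to the complement of the cluster is fresh, so a function b of
   it factors out. *)
Lemma Ex_explored_indep (phi : nat -> nat -> R)
    (b : {set {set T}} -> {set T} -> R) (B : R) S Rt :
  (forall t e, 0 <= phi t e) ->
  (forall E U, b (E :&: pairs_in U) U = b E U) ->
  (forall U, U \subset S -> Ex p (pairs_in U) (b^~ U) <= B) ->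
  Rt \subset S ->
  Ex p (pairs_in S) (fun E => phi #|reach E S Rt| (edges_within E (reach E S Rt)) *
                              b E (S :\: reach E S Rt)) <=
  Ex p (pairs_in S) (fun E => phi #|reach E S Rt| (edges_within E (reach E S Rt))) * B.
Proof.
move=> + bE + RS; elim/explore_ind: RS phi => {S Rt} [S|S Rt v vR RS IH] phi phi0 bB.
  have E0 E : E \subset pairs_in S ->
      phi #|reach E S set0| (edges_within E (reach E S set0)) = phi 0%N 0%N.
    by move=> ES; rewrite reach_set0 (edges_within_set0 ES) cards0.
  rewrite (eq_Ex p E0) Ex_cst.
  rewrite (@eq_Ex _ p _ _ _ (fun E => phi 0%N 0%N * b E S)) => [|E ES]; last first.
    by rewrite E0 // reach_set0 setD0.
  by rewrite ExZ ler_wpM2l // bB.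
have vS := subsetP RS v vR.
rewrite (Ex_explore p (fun _ t e => phi t e) vR RS) (Ex_star _ _ vS).
rewrite mulrC -ExZ; apply: le_Ex => // N NS; rewrite mulrC.
apply: le_trans (IH N NS (fun t e => phi t.+1 (#|N| + e)%N) _ _) => [|//|U US]; last first.
  by apply: bB; apply: subset_trans US _; exact: subD1set.
apply: le_Ex => // E ES; rewrite card_reach_explore // edges_explore //.
rewrite reach_explore //.
by rewrite -setDDl -bE unexplored_pairs bE.
Qed.

Lemma Ex_nbr_explored_indep (phi : nat -> nat -> nat -> R)
    (b : {set {set T}} -> {set T} -> R) (B : R) S x :
  (forall d t e, 0 <= phi d t e) ->
  (forall E U, b (E :&: pairs_in U) U = b E U) ->
  (forall U, U \subset S -> Ex p (pairs_in U) (b^~ U) <= B) ->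
  x \in S ->
  Ex p (pairs_in S) (fun E =>
    phi #|nbr E S x| #|reach E S [set x]| (edges_within E (reach E S [set x])) *
    b E (S :\: reach E S [set x])) <=
  Ex p (pairs_in S) (fun E =>
    phi #|nbr E S x| #|reach E S [set x]| (edges_within E (reach E S [set x]))) * B.
Proof.
move=> phi0 bE bB xS; have RS : [set x] \subset S by rewrite sub1set.
rewrite (Ex_explore p (fun N t e => phi #|N| t e) (set11 x) RS) (Ex_star _ _ xS).
rewrite mulrC -ExZ; apply: le_Ex => // N NS; rewrite mulrC.
have NS' : [set x] :\ x :|: N \subset S :\ x by apply: roots_explore.
apply: le_trans (Ex_explored_indep (phi := fun t e => phi #|N| t.+1 (#|N| + e)%N) _ bE _ NS') => [|//|U US]; last first.
  by apply: bB; apply: subset_trans US _; exact: subD1set.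
apply: le_Ex => // E ES; rewrite {1}/nbr (nbrs_explore NS ES).
rewrite card_reach_explore ?set11 // edges_explore ?set11 //.
by rewrite reach_explore ?set11 // -setDDl -bE unexplored_pairs bE.
Qed.


End Exploration.

From mathcomp Require Import reals.

(** * Modularity and connected components *)

Section Components.
Variables (T : finType) (G : graph T).
Implicit Types (A C X : {set T}) (x y : T).

Definition component x : {set T} := reach (edges G) [set: T] [set x].

Lemma edges_pairs : edges G \subset pairs_in [set: T].
Proof. by apply/subsetP => e /card_edge ce; rewrite inE ce subsetT. Qed.

Lemma mem_component x y : (y \in component x) = connect (adj G) x y.
Proof.
have e : link (edges G) [set: T] =2 adj G.
  by move=> a b; rewrite linkE !in_setT.
apply/reachP/idP => [[r /set1P->]|]; first by rewrite (eq_connect e).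
by exists x; rewrite ?set11 // (eq_connect e).
Qed.

Lemma adj_csym : connect_sym (adj G).
Proof. exact: sym_connect_sym (adj_sym G). Qed.

Lemma component_refl x : x \in component x.
Proof. by rewrite mem_component connect0. Qed.

Lemma component_eq x y : y \in component x -> component y = component x.
Proof.
rewrite mem_component => xy; apply/setP => z; rewrite !mem_component.
by rewrite (same_connect adj_csym xy).
Qed.

Lemma component_adj x y z : y \in component x -> adj G y z -> z \in component x.
Proof. by rewrite !mem_component => xy yz; apply: connect_trans xy (connect1 yz). Qed.

Lemma componentsP C : C \in components G -> exists2 x, x \in C & C = component x.
Proof.
case/imsetP=> x _ ->; exists x; first by rewrite !inE connect0.
by apply/setP => y; rewrite mem_component !inE.
Qed.

Lemma degree_nbr x : degree G x = #|nbr (edges G) [set: T] x|.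
Proof.
apply: eq_card => y; rewrite !inE andbT /adj; case: eqVneq => [->|//].
by rewrite [_ \in _](adj_irr G x).
Qed.

Definition indeg A x : nat := #|[set y in A | adj G x y]|.

Lemma degree_indeg x : degree G x = indeg [set: T] x.
Proof. by apply: eq_card => y; rewrite !inE. Qed.

Lemma sum_card (U : finType) (A : {set U}) (P : pred U) :
  (\sum_(i in A) P i)%N = #|[set i in A | P i]|.
Proof.
rewrite -sum1_card big_mkcond [RHS]big_mkcond; apply: eq_bigr => i _.
by rewrite inE; case: (i \in A) (P i) => -[].
Qed.

Lemma sum_indeg A : (\sum_(x in A) indeg A x = 2 * edges_in G A)%N.
Proof.
transitivity (\sum_(x in A) \sum_(e in [set e in edges G | e \subset A]) (x \in e))%N.
  apply: eq_bigr => x xA; rewrite sum_card.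
  rewrite -[LHS](card_imset _ (@set2_inj _ x)); apply: eq_card => e.
  apply/imsetP/idP => [[y + ->]|].
    rewrite !inE => /andP[yA xy]; rewrite eqxx andbT.
    apply/andP; split=> //.
    by apply/subsetP => z; rewrite !inE => /orP[]/eqP->.
  rewrite !inE => /andP[/andP[eE eA] xe].
  move/eqP/cards2P: (card_edge eE) => [a [b [ab ee]]].
  have [aA bA] : a \in A /\ b \in A by split; apply: (subsetP eA); rewrite ee !inE eqxx ?orbT.
  move: xe; rewrite ee !inE => /orP[]/eqP xe; rewrite xe; [exists b|exists a] => //.
    by rewrite inE bA /adj -ee.
  by rewrite inE aA /adj setUC -ee.
  by rewrite setUC.
rewrite exchange_big /= /edges_in -[in RHS]sum1_card big_distrr /=; apply: eq_bigr => e.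
rewrite inE => /andP[/card_edge ce eA]; rewrite muln1 sum_card.
transitivity #|e|; last by rewrite ce.
apply: eq_card => x; rewrite inE.
by case: (boolP (x \in e)) => [/(subsetP eA)->|_]; rewrite ?andbF.
Qed.

Definition edge_cut A : nat := (\sum_(x in A) indeg (~: A) x)%N.

Lemma volume_cut A : volume G A = (2 * edges_in G A + edge_cut A)%N.
Proof.
rewrite -sum_indeg /edge_cut -big_split /=; apply: eq_bigr => x _.
rewrite /degree -(cardsID A); congr (_ + _)%N; apply: eq_card => y.
  by rewrite !inE andbC.
by rewrite !inE andbC.
Qed.

Lemma volume_component x : volume G (component x) = (2 * edges_in G (component x))%N.
Proof.
rewrite volume_cut /edge_cut big1 ?addn0 // => y yx; apply/eqP; rewrite cards_eq0.
apply/eqP/setP => z; rewrite [RHS]inE inE in_setC.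
by apply/negP => /andP[/negP zx /(component_adj yx)].
Qed.

Lemma sum_degree : (\sum_x degree G x = 2 * nb_edges G)%N.
Proof.
rewrite -(eq_bigr _ (fun x _ => esym (degree_indeg x))).
transitivity (\sum_(x in [set: T]) indeg [set: T] x)%N.
  by apply: eq_bigl => x; rewrite inE.
rewrite sum_indeg; congr (2 * _)%N; apply: eq_card => e.
by rewrite !inE subsetT andbT.
Qed.

Lemma cut_gt0 x A : A \subset component x -> A != set0 -> A != component x -> (0 < edge_cut A)%N.
Proof.
move=> AC /set0Pn[a aA] AnC; rewrite lt0n; apply: contra AnC => /eqP A0.
rewrite eqEsubset AC -(component_eq (subsetP AC a aA)) /=.
apply: reach_min => [|y z yA]; first by rewrite sub1set.
rewrite linkE => /and3P[_ _ yz]; apply/negPn/negP => zA.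
move/eqP: A0; rewrite /edge_cut sum_nat_eq0 => /forall_inP/(_ y yA).
by rewrite cards_eq0 => /eqP/setP/(_ z); rewrite !inE zA [adj _ _ _]yz.
Qed.

Section Partition.
Variables (P : {set {set T}}) (hP : partition P [set: T]).

Lemma sum_partition (V : nmodType) A (F : T -> V) :
  \sum_(x in A) F x = \sum_(B in P) \sum_(x in A :&: B) F x.
Proof.
transitivity (\sum_(x in [set: T] | x \in A) F x).
  by apply: eq_bigl => x; rewrite inE.
rewrite (set_partition_big_cond _ hP); apply: eq_bigr => B _.
by apply: eq_bigl => x; rewrite inE andbC.
Qed.

End Partition.

Let hC : partition (components G) [set: T] := components_partition G.

Lemma edges_in_components A :
  (\sum_(C in components G) edges_in G (A :&: C) = edges_in G A)%N.
Proof.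
apply/eqP; rewrite -(eqn_pmul2l (isT : 0 < 2)%N) big_distrr /= -sum_indeg.
rewrite (sum_partition hC); apply/eqP; apply: eq_bigr => C /componentsP[x _ ->].
rewrite -sum_indeg; apply: eq_bigr => y; rewrite in_setI => /andP[_ yx].
apply: eq_card => z; rewrite [LHS]inE [RHS]inE in_setI -andbA; congr (_ && _).
by apply/andP/idP => [[]//|yz]; split => //; exact: component_adj yz.
Qed.

Variable R : realType.

Definition vol2 : R := \sum_(C in components G) (volume G C)%:R ^+ 2.

Lemma vol2E : vol2 = \sum_x (degree G x)%:R * (volume G (component x))%:R.
Proof.
rewrite -(eq_bigl _ _ (fun x => in_setT x)) (sum_partition hC).
apply: eq_bigr => C /componentsP[x _ ->].
rewrite setTI; under [RHS]eq_bigr => y yx do rewrite (component_eq yx).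
by rewrite -mulr_suml -natr_sum expr2.
Qed.

Lemma mod_score_components : (0 < nb_edges G)%N ->
  1 - mod_score G (components G) = vol2 / (4 * (nb_edges G)%:R ^+ 2) :> R.
Proof.
move=> m0; rewrite /mod_score -natr_sum.
have -> : (\sum_(A in components G) edges_in G A = nb_edges G)%N.
  transitivity (edges_in G [set: T]).
    by rewrite -edges_in_components; apply: eq_bigr => C _; rewrite setTI.
  by apply: eq_card => e; rewrite !inE subsetT andbT.
rewrite mulVf ?pnatr_eq0 -?lt0n // opprB addrCA subrr addr0.
by rewrite mulrC.
Qed.

Hypothesis small_components : forall x, (edges_in G (component x) ^ 2 <= 2 * nb_edges G)%N.

(* If X = A :&: C is a proper part of C then vol X (vol C - vol X) <= e(C)^2 by
   AM-GM, while at least one edge leaves X. *)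
Lemma mod_score_part_le A C : C \in components G ->
  4 * (nb_edges G)%:R * (edges_in G (A :&: C))%:R - (volume G (A :&: C))%:R ^+ 2 <=
  2 * (nb_edges G)%:R * (volume G (A :&: C))%:R -
  (volume G (A :&: C))%:R * (volume G C)%:R :> R.
Proof.
case/componentsP=> x _ ->; set X := A :&: component x.
have XC : X \subset component x by exact: subsetIr.
have vX := volume_cut X; have vC := volume_component x.
have sX : (volume G X <= volume G (component x))%N.
  by rewrite /volume [leqRHS](big_setID X) /= (setIidPr XC) leq_addr.
suff : (volume G X * (volume G (component x) - volume G X) <= 2 * nb_edges G * edge_cut X)%N.
  rewrite -(ler_nat R) !natrM natrB // => H.
  have : (nb_edges G)%:R * (volume G X)%:R =
      (nb_edges G)%:R * (2 * (edges_in G X)%:R + (edge_cut X)%:R) :> R.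
    by rewrite vX natrD natrM.
  by move: H; lra.
case: (eqVneq X set0) => [->|X0]; first by rewrite /volume big_set0.
case: (eqVneq X (component x)) => [->|X1]; first by rewrite subnn muln0.
have c0 := cut_gt0 XC X0 X1; have := small_components x; move: c0 sX; rewrite vC.
move: (volume G X) (edge_cut X) (edges_in G (component x)) (nb_edges G); clear.
move=> v c e m c0 ve em; apply: (@leq_trans (2 * m)); last by nia.
apply: leq_trans em; have := leq_of_leqif (nat_AGM2 v (2 * e - v)).
by rewrite subnKC // expnMn leq_pmul2l.
Qed.

Lemma modularity_components :
  modularity G = mod_score G (components G) :> R.
Proof.
apply/eqP; rewrite eq_le modularity_ge ?andbT //.
have [P hP ->] := modularity_attained G R.
have [m0|m0] := posnP (nb_edges G).
  by rewrite /mod_score m0 expr0n /= mulr0 invr0 !mul0r.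
have mE Q : mod_score G Q = (4 * (nb_edges G)%:R ^+ 2)^-1 *
    \sum_(A in Q) (4 * (nb_edges G)%:R * (edges_in G A)%:R - (volume G A)%:R ^+ 2) :> R.
  rewrite /mod_score big_split /= sumrN -mulr_sumr mulrBr; congr (_ - _).
  by field; rewrite pnatr_eq0 -lt0n.
rewrite !mE ler_wpM2l ?invr_ge0 ?mulr_ge0 ?exprn_ge0 //.
apply: (@le_trans _ _ (\sum_(A in P) \sum_(C in components G)
  (2 * (nb_edges G)%:R * (volume G (A :&: C))%:R -
   (volume G (A :&: C))%:R * (volume G C)%:R))).
  apply: ler_sum => A _; apply: le_trans (ler_sum _ (fun C => @mod_score_part_le A C)).
  rewrite big_split /= sumrN -mulr_sumr -natr_sum edges_in_components lerD2l lerN2.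
  have -> : volume G A = (\sum_(C in components G) volume G (A :&: C))%N.
    exact: (sum_partition hC A (degree G)).
  rewrite natr_sum expr2 mulr_suml; apply: ler_sum => C CC.
  rewrite expr2 ler_wpM2l // (bigD1 C) //= lerDl sumr_ge0 //.
rewrite exchange_big /=; apply: ler_sum => C CC.
rewrite big_split /= sumrN -mulr_sumr -mulr_suml -natr_sum.
have -> : (\sum_(A in P) volume G (A :&: C) = volume G C)%N.
  rewrite /volume (sum_partition hP C); apply: eq_bigr => A _.
  by apply: eq_bigl => x; rewrite !inE andbC.
have [x _ ->] := componentsP CC.
by rewrite {1}volume_component natrM -expr2; lra.
Qed.

End Components.

(** * From graph events to expectations *)

Section Bridge.
Variables (R : realType) (T : finType) (p : R).
Implicit Types (P Q : pred (graph T)) (E : {set {set T}}) (S U : {set T}) (x y : T).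

Local Notation allp := (pairs_in [set: T]).
Local Notation EE := (Ex p allp).

Lemma pairsE : pairs T = allp.
Proof. by apply/setP => e; rewrite !inE subsetT andbT. Qed.

Lemma graph_of E : E \subset allp -> exists G : graph T, edges G = E.
Proof.
move=> /subsetP EP; have h : [forall e in E, #|e| == 2].
  by apply/forall_inP => e /EP; rewrite inE => /andP[].
by exists (Graph h).
Qed.

Lemma gnp_massE (G : graph T) :
  gnp_mass p G = p ^+ #|edges G| * (1 - p) ^+ #|allp :\: edges G|.
Proof.
rewrite /gnp_mass pairsE (bigID (mem (edges G))) /=; congr (_ * _).
  rewrite -prodr_const; apply: eq_big => e; last by move=> /andP[_ ->].
  by case: (boolP (e \in edges G)) => [/(subsetP (edges_pairs G))->|]; rewrite ?andbF.
rewrite -prodr_const; apply: eq_big => e; first by rewrite in_setD andbC.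
by move=> /andP[_ /negbTE ->].
Qed.

Lemma Ex_gnp (F : {set {set T}} -> R) :
  EE F = \sum_(G : graph T) gnp_mass p G * F (edges G).
Proof.
rewrite /Ex (reindex_omap (@edges T) insub) => [|E EA] /=.
  apply: eq_big => [G|G _]; last by rewrite gnp_massE.
  by rewrite valK eqxx andbT edges_pairs.
by have [G <-] := graph_of EA; rewrite valK.
Qed.

Hypothesis p01 : 0 <= p <= 1.

Lemma gnp_prob_le P (F : {set {set T}} -> R) :
  (forall E, 0 <= F E) -> (forall G, P G -> 1 <= F (edges G)) ->
  gnp_prob p P <= EE F.
Proof.
move=> F0 F1; rewrite Ex_gnp /gnp_prob [leRHS](bigID P) /=.
rewrite -[leLHS]addr0; apply: lerD.
  by apply: ler_sum => G PG; rewrite ler_peMr ?gnp_mass_ge0 ?F1.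
by apply: sumr_ge0 => G _; rewrite mulr_ge0 ?gnp_mass_ge0.
Qed.

Lemma gnp_prob_ge0 P : 0 <= gnp_prob p P.
Proof. by apply: sumr_ge0 => G _; exact: gnp_mass_ge0. Qed.

Lemma gnp_prob_sub P Q : (forall G, P G -> Q G) -> gnp_prob p P <= gnp_prob p Q.
Proof.
move=> PQ; rewrite /gnp_prob [leRHS](bigID P) /= -[leLHS]addr0; apply: lerD.
  rewrite (eq_bigl (fun G => Q G && P G)) // => G.
  by case: (boolP (P G)) => [/PQ ->|]; rewrite ?andbF.
by apply: sumr_ge0 => G _; exact: gnp_mass_ge0.
Qed.

Lemma gnp_probC P : gnp_prob p P = 1 - gnp_prob p (predC P).
Proof.
rewrite -(gnp_probT T p) /gnp_prob [X in _ = X - _](bigID P) /=.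
by rewrite addrK.
Qed.

Lemma gnp_probU P Q : gnp_prob p (predU P Q) <= gnp_prob p P + gnp_prob p Q.
Proof.
rewrite /gnp_prob (bigID P) /=; apply: lerD.
  by rewrite (eq_bigl P) // => G /=; case: (P G); rewrite ?andbF ?andbT.
rewrite [leRHS](bigID P) /= -[leLHS]add0r; apply: lerD.
  by apply: sumr_ge0 => G _; exact: gnp_mass_ge0.
by rewrite (eq_bigl (fun G => Q G && ~~ P G)) // => G /=; case: (P G); rewrite ?andbF ?andbT.
Qed.

Lemma gnp_prob_exists (I : finType) (A : pred I) (P : I -> pred (graph T)) :
  gnp_prob p (fun G => [exists i, A i && P i G]) <= \sum_(i | A i) gnp_prob p (P i).
Proof.
rewrite /gnp_prob; under [leRHS]eq_bigr do rewrite big_mkcond.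
rewrite exchange_big /= [leLHS]big_mkcond /=; apply: ler_sum => G _.
have h0 i : 0 <= (if P i G then gnp_mass p G else 0).
  by case: ifP => // _; exact: gnp_mass_ge0.
case: ifP => [/existsP[i /andP[Ai Pi]]|_]; last by apply: sumr_ge0.
by rewrite (bigD1 i) //= Pi lerDl sumr_ge0.
Qed.

Lemma Ex_setI (U : finType) (A B : {set U}) (F : {set U} -> R) :
  B \subset A -> Ex p A (fun C => F (C :&: B)) = Ex p B F.
Proof.
move=> BA; rewrite -{1}(setID A B) (setIidPr BA) ExU; last first.
  by rewrite disjoint_sym disjoints_subset; apply/subsetP => y; rewrite !inE => /andP[].
apply: eq_Ex => E1 E1B; rewrite -[RHS](Ex_cst p (A :\: B)); apply: eq_Ex => E2 E2A.
congr F; rewrite setIUl (setIidPl E1B); apply/setP => y; rewrite !inE.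
by case: (boolP (y \in E2)) => [/(subsetP E2A)|]; rewrite ?inE ?orbF // => /andP[/negbTE -> _]; rewrite orbF.
Qed.

Lemma reach_mono E E' (S S' A : {set T}) : E \subset E' -> S \subset S' ->
  reach E S A \subset reach E' S' A.
Proof.
move=> EE' SS'; apply: reach_min => [|x y xW]; first exact: reach_roots.
rewrite linkE => /and3P[xS yS xy]; apply: reach_step xW _.
by rewrite linkE !(subsetP SS') // (subsetP EE').
Qed.

Lemma edges_within_mono E E' (W W' : {set T}) : E \subset E' -> W \subset W' ->
  (edges_within E W <= edges_within E' W')%N.
Proof.
move=> EE' WW'; apply: subset_leq_card; apply/subsetP => e; rewrite !inE.
by case/andP=> /(subsetP EE')-> eW; exact: subset_trans WW'.
Qed.

Definition deg_edges E S x : R :=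
  #|nbr E S x|%:R * (2 * edges_within E (reach E S [set x]))%:R.

Lemma deg_edges_ge0 E S x : 0 <= deg_edges E S x.
Proof. by rewrite mulr_ge0. Qed.

Lemma deg_edges_mono E E' S S' x : E \subset E' -> S \subset S' ->
  deg_edges E S x <= deg_edges E' S' x.
Proof.
move=> EE' SS'; apply: ler_pM => //; rewrite ler_nat; last first.
  by rewrite leq_mul2l edges_within_mono ?reach_mono ?orbT.
apply: subset_leq_card; apply/subsetP => y; rewrite !inE.
by case/andP=> /andP[-> /(subsetP SS')->] /(subsetP EE')->.
Qed.

Lemma deg_edges_unexplored E x y : E \subset allp ->
  let U := [set: T] :\: reach E [set: T] [set x] in y \in U ->
  deg_edges E [set: T] y <= deg_edges (E :&: pairs_in U) U y.
Proof.
move=> EA U yU.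
have cU a b : a \in U -> b != a -> [set a; b] \in E -> (b \in U) && ([set a; b] \in pairs_in U).
  move=> aU ba ab; have bU : b \in U.
    move: aU; rewrite !in_setD !in_setT !andbT; apply: contra => bW.
    by apply: reach_step bW _; rewrite linkE !in_setT setUC.
  rewrite bU /= inE cards2 [a == b]eq_sym ba /=.
  by apply/subsetP => z; rewrite in_set2 => /orP[]/eqP->.
have rU : reach E [set: T] [set y] \subset reach (E :&: pairs_in U) U [set y].
  apply: reach_min => [|a b aW]; first exact: reach_roots.
  rewrite linkE => /and3P[_ _ ab]; have aU : a \in U.
    by apply: (subsetP (reach_sub _ _)) aW; rewrite sub1set.
  case: (eqVneq b a) => [-> //|ba]; have /andP[bU abU] := cU _ _ aU ba ab.
  by apply: reach_step aW _; rewrite linkE aU bU in_setI ab.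
apply: ler_pM => //; rewrite ler_nat.
  apply: subset_leq_card; apply/subsetP => b.
  rewrite !inE andbT -/U => /andP[by_ yb]; have /andP[bU ybU] := cU _ _ yU by_ yb.
  by rewrite by_ yb /=; move: bU ybU; rewrite !inE => -> ->.
rewrite leq_mul2l /=; apply: subset_leq_card; apply/subsetP => e.
rewrite !inE => /andP[eE eW]; rewrite eE (subset_trans eW rU) andbT /=.
have := subsetP EA e eE; rewrite inE => /andP[-> _] /=.
apply: subset_trans eW (subset_trans rU (reach_sub _ _)).
by rewrite sub1set.
Qed.

Definition sum_deg_edges E : R := \sum_x deg_edges E [set: T] x.

Lemma sum_deg_edgesE (G : graph T) : sum_deg_edges (edges G) = vol2 G R.
Proof.
rewrite vol2E; apply: eq_bigr => x _.
by rewrite /deg_edges degree_nbr volume_component.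
Qed.

Lemma Ex_deg_edgesM x y :
  EE (fun E => (y \notin reach E [set: T] [set x])%:R *
     (deg_edges E [set: T] x * deg_edges E [set: T] y)) <=
  EE (fun E => deg_edges E [set: T] x) * EE (fun E => deg_edges E [set: T] y).
Proof.
pose b E U : R := (y \in U)%:R * deg_edges (E :&: pairs_in U) U y.
apply: le_trans (Ex_nbr_explored_indep p01
    (phi := fun d _ e => d%:R * (2 * e)%:R) (b := b) _ _ _ (in_setT x)); last first.
- move=> U UT; rewrite /b; case: (boolP (y \in U)) => yU; last first.
    under eq_Ex do rewrite mul0r.
    by rewrite Ex_cst Ex_ge0 // => E _; exact: deg_edges_ge0.
  have sU : pairs_in U \subset allp.
    by apply/subsetP => e; rewrite !inE subsetT => /andP[->].
  under eq_Ex do rewrite mul1r.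
  rewrite (Ex_setI (fun E => deg_edges E U y) (subxx _)).
  rewrite -(Ex_setI (fun E => deg_edges E U y) sU); apply: le_Ex => // E _.
  by apply: deg_edges_mono; rewrite ?subsetIl ?subsetT.
- by move=> E U; rewrite /b -setIA setIid.
- by move=> d t e; rewrite mulr_ge0.
apply: le_Ex => // E EA; rewrite mulrCA ler_wpM2l ?deg_edges_ge0 //.
rewrite /b in_setD in_setT andbT.
case: (boolP (y \in _)) => [|yx]; first by rewrite !mul0r.
by rewrite !mul1r; apply: deg_edges_unexplored; rewrite // in_setD yx in_setT.
Qed.

Lemma Ex_sum_deg_edges_sqr :
  EE (fun E => sum_deg_edges E ^+ 2) <= EE sum_deg_edges ^+ 2 +
   \sum_x EE (fun E => #|nbr E [set: T] x|%:R *
     (2 * edges_within E (reach E [set: T] [set x]))%:R ^+ 3).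
Proof.
pose a E x := deg_edges E [set: T] x.
pose r E x := reach E [set: T] [set x].
have -> : EE (fun E => sum_deg_edges E ^+ 2) =
    EE (fun E => \sum_x \sum_y (y \notin r E x)%:R * (a E x * a E y)) +
    EE (fun E => \sum_x \sum_y (y \in r E x)%:R * (a E x * a E y)).
  rewrite -ExD; apply: eq_Ex => E _; rewrite expr2 mulr_suml -big_split /=.
  apply: eq_bigr => x _; rewrite mulr_sumr -big_split /=; apply: eq_bigr => y _.
  by case: (y \in _); rewrite !(mul0r, mul1r) ?add0r ?addr0.
apply: lerD.
  rewrite Ex_sum /sum_deg_edges !Ex_sum expr2 mulr_suml; apply: ler_sum => x _.
  by rewrite Ex_sum mulr_sumr; apply: ler_sum => y _; exact: Ex_deg_edgesM.
rewrite Ex_sum; apply: ler_sum => x _; apply: le_Ex => // E EA.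
have [G GE] := graph_of EA; rewrite -GE.
pose e : R := (2 * edges_within (edges G) (component G x))%:R.
have -> : \sum_y (y \in component G x)%:R * (a (edges G) x * a (edges G) y) =
    a (edges G) x * (e * (\sum_(y in component G x) degree G y)%:R).
  rewrite natr_sum !mulr_sumr [RHS]big_mkcond; apply: eq_bigr => y _.
  case: ifP => yx; last by rewrite mul0r.
  rewrite mul1r; congr (_ * _); rewrite mulrC /a /deg_edges -degree_nbr.
  by rewrite -[reach _ _ [set y]]/(component G y) (component_eq yx).
have -> : (\sum_(y in component G x) degree G y = 2 * edges_within (edges G) (component G x))%N.
  exact: volume_component.
by rewrite -/e /a /deg_edges -[reach _ _ _]/(component G x) -/e !exprS expr0 mulr1 !mulrA.
Qed.

End Bridge.

From mathcomp Require Import topology normedtype derive sequences exp.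
Import numFieldNormedType.Exports.

Lemma derive_ge0 (R : realType) (f df : R -> R) :
  (forall x : R, is_derive x 1 f (df x)) -> f 0 = 0 ->
  (forall x, 0 <= x -> 0 <= df x) -> forall x, 0 <= x -> 0 <= f x.
Proof.
move=> fd f0 df0 x; rewrite le_eqVlt => /predU1P[<-|x0]; first by rewrite f0.
have [|c + ] := @MVT_segment R f df 0 x (ltW x0) (fun z _ => fd z).
  apply: derivable_within_continuous => z _; exact: ex_derive.
by rewrite in_itv /= f0 !subr0 => /andP[c0 _] ->; rewrite mulr_ge0 ?df0 // ltW.
Qed.

Lemma expRN_taylor3 (R : realType) (x : R) : 0 <= x ->
  1 - x + x ^+ 2 / 2 - x ^+ 3 / 6 <= expR (- x).
Proof.
have h1 (y : R) : 0 <= y -> 0 <= expR (- y) - (1 - y).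
  by move=> _; have := expR_ge1Dx (- y); lra.
have h2 (y : R) : 0 <= y -> 0 <= 1 - y + y ^+ 2 / 2 - expR (- y).
  pose f (y : R) := 1 - y + y ^+ 2 / 2 - expR (- y).
  apply: (derive_ge0 (f := f) _ _ h1) => [z|]; last by rewrite /f oppr0 expR0; lra.
  by apply: is_derive_eq; rewrite /GRing.scale /=; lra.
have h3 (y : R) : 0 <= y -> 0 <= expR (- y) - (1 - y + y ^+ 2 / 2 - y ^+ 3 / 6).
  pose f (y : R) := expR (- y) - (1 - y + y ^+ 2 / 2 - y ^+ 3 / 6).
  apply: (derive_ge0 (f := f) _ _ h2) => [z|]; last by rewrite /f oppr0 expR0; lra.
  by apply: is_derive_eq; rewrite /GRing.scale /=; lra.
by move=> x0; have := h3 x x0; rewrite subr_ge0.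
Qed.

Section ExpBounds.
Variable R : realType.
Implicit Types x y : R.

Lemma expR_le1D x : 0 <= x <= 1 -> expR (x - x ^+ 2 / 2) <= 1 + x.
Proof.
move=> /andP[x0 x1]; have y0 : 0 <= x - x ^+ 2 / 2 by nra.
have := expRN_taylor3 y0; rewrite expRN => h.
rewrite -[leLHS]invrK -[leRHS]invrK lef_pV2 ?posrE ?invr_gt0 ?expR_gt0 //; last by lra.
apply: le_trans _ h; rewrite -[leLHS]mul1r ler_pdivrMr; last by lra.
set P := leRHS; have -> : P = 1 + x ^+ 3 * (1 / 3 - 7 / 24 * x +
    x ^+ 2 * (1 / 4 - 5 / 48 * x) + x ^+ 4 / 48) by rewrite /P; field.
rewrite lerDl mulr_ge0 ?exprn_ge0 // addr_ge0 ?divr_ge0 ?exprn_ge0 //.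
by rewrite addr_ge0 ?mulr_ge0 ?exprn_ge0 //; lra.
Qed.

Lemma expR_cube y : 0 <= y -> (1 + y / 3) ^+ 3 <= expR y.
Proof.
move=> y0; have -> : expR y = expR (y / 3) ^+ 3 by rewrite -expRM_natl; congr expR; field.
by rewrite lerXn2r ?nnegrE ?expR_ge0 ?expR_ge1Dx //; lra.
Qed.

Lemma expR_sub1_lin y : y <= expR y - 1.
Proof. by have := expR_ge1Dx y; lra. Qed.

Lemma expR_sub1_sqr y : 0 <= y -> y ^+ 2 <= 3 * (expR y - 1).
Proof. by move=> y0; have := expR_cube y0; nra. Qed.

Lemma expR_sub1_cube y : 0 <= y -> y ^+ 3 <= 27 * (expR y - 1).
Proof. by move=> y0; have := expR_cube y0; nra. Qed.

Lemma expR_sub1_le x : 0 <= x <= 1 / 2 -> expR x - 1 <= x + 2 * x ^+ 2.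
Proof.
move=> /andP[x0 x1]; have := expR_ge1Dx (- x); rewrite expRN => h.
have e0 : 0 < expR x := expR_gt0 _.
have h1 : expR x * (1 - x) <= 1.
  by rewrite -[leRHS](mulfV (lt0r_neq0 e0)) ler_wpM2l // ltW.
have : expR x * (1 - x) <= (1 + x + 2 * x ^+ 2) * (1 - x) by nra.
by rewrite ler_pM2r; lra.
Qed.

Lemma expR1_le4 : expR 1 <= 4 :> R.
Proof.
have := expR_ge1Dx (- (1 / 2) : R); rewrite expRN => h.
have e0 : 0 < expR (1 / 2) :> R := expR_gt0 _.
have h2 : expR (1 / 2) <= 2 :> R.
  rewrite -[leLHS]invrK -[leRHS]invrK lef_pV2 ?posrE ?invr_gt0 //; lra.
have -> : expR 1 = expR (1 / 2) ^+ 2 :> R by rewrite -expRM_natl; congr expR; field.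
by nra.
Qed.

Lemma expR_pow_le x n : 0 <= 1 + x -> (1 + x) ^+ n <= expR (n%:R * x).
Proof. by move=> x0; rewrite expRM_natl lerXn2r ?nnegrE ?expR_ge0 ?expR_ge1Dx. Qed.

End ExpBounds.

Section EdgeTails.
Variables (R : realType) (T : finType) (p : R).
Hypothesis p01 : 0 <= p <= 1.
Local Notation n := (#|T|%:R : R).

Lemma card_pairs_in : #|pairs_in [set: T]|%:R = n * (n - 1) / 2 :> R.
Proof.
have -> : #|pairs_in [set: T]| = 'C(#|T|, 2).
  rewrite -card_draws; apply: eq_card => e; by rewrite !inE subsetT andbT.
have [->|n0] := posnP #|T|; first by rewrite bin0n !mul0r.
have : ((2 * 'C(#|T|, 2))%N = (#|T| * #|T|.-1)%N) by rewrite -mul_bin_diag bin1.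
move/(congr1 (fun k => k%:R : R)); rewrite !natrM -[#|T|.-1]subn1 natrB // => h.
by rewrite -h mulrAC mulfV ?mul1r ?pnatr_eq0.
Qed.

Lemma nb_edges_lower (d : R) : 0 <= d <= 1 ->
  gnp_prob p (fun G : graph T =>
    (nb_edges G)%:R <= (1 - 2 * d) * (p * (n * (n - 1) / 2))) <=
  expR (- (d ^+ 2 * (p * (n * (n - 1) / 2)))).
Proof.
case/andP: (p01) => p0 p1 /andP[d0 d1]; set N := p * _.
have N0 : 0 <= N by rewrite /N -card_pairs_in mulr_ge0.
pose c := expR (d * ((1 - 2 * d) * N)).
apply: le_trans (gnp_prob_le p01 (F := fun E => c * expR (- d) ^+ #|E|) _ _) _.
- by move=> E; rewrite mulr_ge0 ?exprn_ge0 ?expR_ge0.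
- move=> G h; rewrite -expRM_natl -expRD -[leLHS]expR0 ler_expR.
  by move: (ler_wpM2l d0 h); rewrite /nb_edges; lra.
have w1 : expR (- d) <= 1 by rewrite expR_le1; lra.
rewrite ExZ Ex_pow; apply: (@le_trans _ _ (c * expR (#|pairs_in [set: T]|%:R * (p * (expR (- d) - 1))))).
  rewrite ler_wpM2l ?expR_ge0 //; apply: expR_pow_le.
  have := expR_ge0 (- d); nra.
rewrite -expRD ler_expR card_pairs_in.
have -> : n * (n - 1) / 2 * (p * (expR (- d) - 1)) = N * (expR (- d) - 1).
  by rewrite /N; ring.
have : expR (- d) <= 1 - d + d ^+ 2.
  rewrite expRN; apply: (@le_trans _ _ (1 + d)^-1).
    by rewrite lef_pV2 ?posrE ?expR_gt0 ?expR_ge1Dx //; lra.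
  by rewrite -[leLHS]mul1r ler_pdivrMr; [nra|lra].
by move/(ler_wpM2l N0); lra.
Qed.

Lemma nb_edges_upper :
  gnp_prob p (fun G : graph T => 3 * (n ^+ 2 * p) <= (nb_edges G)%:R) <=
  expR (- (n ^+ 2 * p)).
Proof.
case/andP: (p01) => p0 p1; set N := n ^+ 2 * p.
have N0 : 0 <= N by rewrite mulr_ge0 // exprn_ge0.
apply: le_trans (gnp_prob_le p01 (F := fun E => expR (- (3 * N)) * expR 1 ^+ #|E|) _ _) _.
- by move=> E; rewrite mulr_ge0 ?exprn_ge0 ?expR_ge0.
- move=> G h; rewrite -expRM_natl -expRD -[leLHS]expR0 ler_expR.
  by move: h; rewrite /nb_edges; lra.
rewrite ExZ Ex_pow -[leRHS](_ : expR (- (3 * N)) * expR (2 * N) = _); last first.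
  by rewrite -expRD; congr expR; lra.
have e4 := expR1_le4 R; have e1 : 1 <= expR 1 :> R by have := expR_ge1Dx (1 : R); lra.
rewrite ler_wpM2l ?expR_ge0 //; apply: le_trans (expR_pow_le _ _) _; first by nra.
rewrite ler_expR card_pairs_in.
have n0 : 0 <= n by [].
have : p * (expR 1 - 1) <= 3 * p by nra.
have : 0 <= p * (expR 1 - 1) by nra.
have : n * (n - 1) / 2 <= n ^+ 2 / 2 by nra.
rewrite /N; move: (n * (n - 1) / 2) (p * (expR 1 - 1)) => a b ha hb hbp.
have n2 : 0 <= n ^+ 2 by rewrite exprn_ge0.
have : a * b <= n ^+ 2 / 2 * b by rewrite ler_wpM2r.
have : n ^+ 2 / 2 * b <= n ^+ 2 / 2 * (3 * p) by rewrite ler_wpM2l //; lra.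
have : 0 <= n ^+ 2 * p by rewrite mulr_ge0.
lra.
Qed.

End EdgeTails.

(** * The subcritical regime *)

Section Subcritical.
Variables (R : realType) (T : finType) (p : R).
Local Notation n := (#|T|%:R : R).
Local Notation allT := ([set: T]%SET).
Local Notation EE := (Ex p (pairs_in allT)).
Local Notation lam := (n * p).
Local Notation eps := (1 - n * p).
Local Notation rch E x := (reach E allT [set x]%SET).
Local Notation D E x := (#|nbr E allT x|%:R : R).
Local Notation e E x := ((edges_within E (rch E x))%:R : R).
Hypotheses (p01 : 0 < p <= 1) (T0 : (0 < #|T|)%N) (eps0 : 0 < eps).
Implicit Types (x : T) (E : {set {set T}}).

Let p01' : 0 <= p <= 1.
Proof. by move: p01; lra. Qed.

Let lam0 : 0 < lam.
Proof. by rewrite mulr_gt0 ?ltr0n //; case/andP: p01. Qed.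

Let th : R := eps ^+ 2 / 2.

Let th0 : 0 < th.
Proof. by rewrite /th divr_gt0 ?exprn_gt0. Qed.

Lemma cardT_D1 x : #|allT :\ x|%SET%:R = n - 1 :> R.
Proof.
have := cardsD1 x allT; rewrite in_setT cardsT => ->.
by rewrite natrD addrAC subrr add0r.
Qed.

(* The parameters are z = e^(eps^2/2) and G = e^(np eps), for which
   z G <= 1 + eps. *)
Lemma Ex_deg_expR x : EE (fun E => D E x * (expR (th * e E x) - 1)) <= 4 * lam * eps.
Proof.
have [p0 p1] := andP p01'; have l0 := lam0; have e0 := eps0.
pose z := expR th; pose G := expR (lam * eps).
have z1 : 1 <= z by rewrite /z; have := expR_ge1Dx th; have := th0; lra.
have G1 : 1 <= G.
  have := expR_ge1Dx (lam * eps); have := mulr_gt0 l0 e0; rewrite /G; lra.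
have zG : z * G <= 1 + eps.
  rewrite /z /G -expRD; have -> : th + lam * eps = eps - eps ^+ 2 / 2 by rewrite /th; field.
  by apply: expR_le1D; lra.
have zG1 : 1 <= z * G by rewrite mulr_ege1.
have hG : (1 + p * (z * G - 1)) ^+ #|T| <= G.
  apply: le_trans (expR_pow_le _ _) _; first by nra.
  rewrite ler_expR mulrA ler_wpM2l //; [lra|lra].
have := Ex_deg_edges_le p01' z1 G1 hG _ (in_setT x).
rewrite cardsT => /(_ (leqnSn _)); rewrite cardT_D1.
have -> : EE (fun E => D E x * (z ^+ edges_within E (rch E x) - 1)) =
    EE (fun E => D E x * (expR (th * e E x) - 1)).
  by apply: eq_Ex => E _; rewrite expRM_natr.
move=> h; apply: le_trans h _.
have G2 : G <= 1 + 4 / 3 * eps.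
  have x4 : lam * eps <= 1 / 4 by have := sqr_ge0 (lam - 1 / 2); lra.
  have x0 : 0 < lam * eps by rewrite mulr_gt0.
  have := expR_ge1Dx (- (lam * eps)); rewrite expRN -/G => h.
  have G0 : 0 < G by lra.
  have : G * (1 - lam * eps) <= 1.
    by rewrite -[leRHS](mulfV (lt0r_neq0 G0)) ler_wpM2l // ltW.
  have : lam * eps <= eps by rewrite ler_piMl; lra.
  by nra.
have zGG : z * G * G - 1 <= 4 * eps by nra.
have zGG0 : 0 <= z * G * G - 1 by nra.
apply: (@le_trans _ _ (lam * (z * G * G - 1))).
  by rewrite ler_wpM2r // mulrC ler_wpM2r //; lra.
have -> : 4 * lam * eps = lam * (4 * eps) by ring.
by rewrite ler_wpM2l // ltW.
Qed.

Let Ex_deg_pow x (k : nat) (c : R) : 0 <= c ->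
  (forall y : R, 0 <= y -> y ^+ k <= c * (expR y - 1)) ->
  EE (fun E => D E x * e E x ^+ k) <= c * 4 * lam * eps / th ^+ k.
Proof.
move=> c0 ck; rewrite ler_pdivlMr ?exprn_gt0 // mulrC -ExZ.
apply: (@le_trans _ _ (c * EE (fun E => D E x * (expR (th * e E x) - 1)))).
  rewrite -ExZ; apply: le_Ex => // E _; rewrite mulrCA [leRHS]mulrCA.
  by rewrite ler_wpM2l // -exprMn ck // mulr_ge0 // ltW.
by apply: le_trans (ler_wpM2l c0 (Ex_deg_expR x)) _; rewrite !mulrA.
Qed.

Lemma Ex_deg_edges1 x : EE (fun E => D E x * e E x) <= 8 * lam / eps.
Proof.
have := @Ex_deg_pow x 1 1 ler01; have -> : 1 * 4 * lam * eps / th ^+ 1 = 8 * lam / eps.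
  by rewrite /th; field; have := eps0; lra.
move=> h; apply: h => y _; rewrite expr1 mul1r; exact: expR_sub1_lin.
Qed.

Lemma Ex_deg_edges2 x : EE (fun E => D E x * e E x ^+ 2) <= 48 * lam / eps ^+ 3.
Proof.
have := @Ex_deg_pow x 2 3 _ _; have -> : 3 * 4 * lam * eps / th ^+ 2 = 48 * lam / eps ^+ 3.
  by rewrite /th; field; have := eps0; lra.
by apply=> //; exact: expR_sub1_sqr.
Qed.

Lemma Ex_deg_edges3 x : EE (fun E => D E x * e E x ^+ 3) <= 27 * 32 * lam / eps ^+ 5.
Proof.
have := @Ex_deg_pow x 3 27 _ _; have -> : 27 * 4 * lam * eps / th ^+ 3 = 27 * 32 * lam / eps ^+ 5.
  by rewrite /th; field; have := eps0; lra.
by apply=> //; exact: expR_sub1_cube.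
Qed.

(* Weighting by degrees counts a component with k edges at least 2 k times. *)
Lemma prob_large_component (k : R) : 0 < k ->
  gnp_prob p (fun G : graph T =>
     [exists x, k <= (edges_in G (component G x))%:R]) <=
  2 * n * lam * eps / (k * (expR (eps ^+ 2 / 2 * k) - 1)).
Proof.
move=> k0; have thk : 0 < th * k by rewrite mulr_gt0.
have a0 : 0 < expR (th * k) - 1 by have := expR_sub1_lin (th * k); lra.
have b0 : 0 < 2 * k * (expR (th * k) - 1) by rewrite !mulr_gt0.
have F0 E x : 0 <= D E x * (expR (th * e E x) - 1).
  rewrite mulr_ge0 // subr_ge0 -[leLHS]expR0 ler_expR mulr_ge0 //; exact: ltW.
apply: le_trans (gnp_prob_le p01' (F := fun E =>
  (2 * k * (expR (th * k) - 1))^-1 * \sum_x D E x * (expR (th * e E x) - 1)) _ _) _.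
- by move=> E; rewrite mulr_ge0 ?invr_ge0 ?(ltW b0) // sumr_ge0.
- move=> G /existsP[x kx]; rewrite mulrC ler_pdivlMr // mul1r.
  rewrite (bigID (mem (component G x))) /= -[leLHS]addr0 lerD ?sumr_ge0 //.
  rewrite (eq_bigr (fun y => (degree G y)%:R *
      (expR (th * (edges_in G (component G x))%:R) - 1))); last first.
    move=> y yx; rewrite -degree_nbr.
    by rewrite -[rch _ _]/(component G y) (component_eq yx).
  rewrite -mulr_suml -natr_sum -/(volume G (component G x)) volume_component natrM.
  apply: ler_pM; [lra|exact: ltW|lra|].
  by rewrite lerD2r ler_expR ler_wpM2l // ltW.
rewrite ExZ Ex_sum mulrC ler_pdivrMr //.
apply: (@le_trans _ _ (\sum_(x : T) 4 * lam * eps)).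
  by apply: ler_sum => x _; exact: Ex_deg_expR.
rewrite sumr_const -mulr_natl; rewrite -/th -[#|xpredT|]/#|T| le_eqVlt; apply/orP; left; apply/eqP.
by field; apply/andP; split; lra.
Qed.

(* With t the number of vertices of the component of x other than x, averaging
   Ex_card_reach_ge over the neighbours of x, taken as roots, gives
   E[deg t] >= E[deg^2] + p E[deg t (n - 1 - t)]; moreover t <= e. *)
Lemma Ex_deg_card_ge x :
  p * (n - 1) <= (1 - p * (n - 1)) * EE (fun E => D E x * e E x) +
     p * EE (fun E => D E x * e E x ^+ 2).
Proof.
pose t E : R := #|rch E x|%:R - 1.
have te E : E \subset pairs_in allT -> 0 <= t E <= e E x.
  move=> EA; rewrite /t; have := card_reach_le EA (subsetT [set x]).
  rewrite cards1 -(ler_nat R) natrD.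
  have := subset_leq_card (reach_roots E allT [set x]); rewrite cards1 -(ler_nat R).
  lra.
pose A := EE (fun E => D E x * t E).
have A1 : A <= EE (fun E => D E x * e E x).
  by apply: le_Ex => // E /te /andP[_ h]; rewrite ler_wpM2l.
have A2 : EE (fun E => D E x * t E ^+ 2) <= EE (fun E => D E x * e E x ^+ 2).
  by apply: le_Ex => // E /te /andP[h1 h2]; rewrite ler_wpM2l // lerXn2r // nnegrE; lra.
suff A3 : p * (n - 1) + p * (n - 1) * A - p * EE (fun E => D E x * t E ^+ 2) <= A.
  have [p0 p1] := andP p01'; have e0 := eps0.
  have : 0 <= 1 - p * (n - 1) by lra.
  move/(ler_wpM2l)/(_ _ _ A1); move: (ler_wpM2l p0 A2); lra.
rewrite -[X in _ <= X]/(EE (fun E => D E x * (#|rch E x|%:R - 1))).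
rewrite (Ex_explore p (fun N t _ => #|N|%:R * (t%:R - 1)) (set11 x) (subsetT _)).
rewrite /A -ExZ -addrA -ExZ -ExB.
rewrite (@eq_Ex _ p _ _ _ (fun E => D E x * (p * (t E * (n - 1 - t E))))); last first.
  by move=> E _; ring.
rewrite (Ex_explore p (fun N t _ => #|N|%:R * (p * ((t%:R - 1) * (n - 1 - (t%:R - 1)))))
   (set11 x) (subsetT _)).
rewrite -(cardT_D1 x) -Ex_card -ExD; apply: le_Ex => // N NS.
under [leRHS]eq_Ex do rewrite -natr1 addrK.
under eq_Ex do rewrite -natr1 addrK.
rewrite !ExZ.
have NS' : ([set x] :\ x :|: N \subset allT :\ x)%SET.
  by rewrite setDv set0U.
have := Ex_card_reach_ge p01' NS'.
have -> : #|([set x] :\ x :|: N)%SET| = #|N| by rewrite setDv set0U.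
move/(ler_wpM2l (ler0n R #|N|)); rewrite mulrDr; apply: le_trans.
by rewrite lerD2r -natrM ler_nat; case: #|N| => // k; rewrite leq_pmulr.
Qed.

End Subcritical.

Section SubcriticalVolume.
Variables (R : realType) (T : finType) (p : R).
Local Notation n := (#|T|%:R : R).
Local Notation EE := (Ex p (pairs_in [set: T]%SET)).
Local Notation mu := (n ^+ 2 * p).
Local Notation eps := (1 - n * p).
Hypotheses (p01 : 0 < p <= 1) (T2 : (10 <= #|T|)%N) (eps0 : 0 < eps).
Hypothesis eps3 : 192 <= mu * eps ^+ 3.

Let p01' : 0 <= p <= 1.
Proof. by move: p01; lra. Qed.

Let T0 : (0 < #|T|)%N.
Proof. exact: leq_trans T2. Qed.

Let n10 : 10 <= n.
Proof. by rewrite ler_nat. Qed.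

Let mu0 : 0 < mu.
Proof. by rewrite mulr_gt0 ?exprn_gt0 ?ltr0n //; case/andP: p01. Qed.

Let e1 : eps < 1.
Proof.
have : 0 < n * p by rewrite mulr_gt0 ?ltr0n //; case/andP: p01.
lra.
Qed.

Lemma Ex_vol2_ge : mu / (4 * eps) <= EE (@sum_deg_edges R T).
Proof.
have [p0 p1] := andP p01; have e0 := eps0; have h10 := n10.
have lam0 : 0 < n * p by rewrite mulr_gt0 //; lra.
have l1 : n * p < 1 by lra.
have K x : n * p / (8 * eps) <= EE (fun E => #|nbr E [set: T]%SET x|%:R *
    (edges_within E (reach E [set: T]%SET [set x]%SET))%:R).
  have := Ex_deg_card_ge p01 eps0 x.
  have := Ex_deg_edges2 p01 T0 eps0 x.
  pose A := EE (fun E => #|nbr E [set: T]%SET x|%:R *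
      (edges_within E (reach E [set: T]%SET [set x]%SET))%:R).
  pose B := EE (fun E => #|nbr E [set: T]%SET x|%:R *
      (edges_within E (reach E [set: T]%SET [set x]%SET))%:R ^+ 2).
  have A0 : 0 <= A by apply: Ex_ge0 => // E _; rewrite mulr_ge0.
  have B0 : 0 <= B by apply: Ex_ge0 => // E _; rewrite mulr_ge0 ?sqr_ge0.
  rewrite -/A -/B; move: A B A0 B0 => A B A0 B0 hB hA.
  have e3 : 0 < eps ^+ 3 by rewrite exprn_gt0.
  have pe : p * 192 <= eps ^+ 3.
    have : n * (p * 192) <= n * eps ^+ 3.
      have mun : mu <= n by rewrite expr2 -mulrA ler_piMr // ltW.
      have := ler_wpM2r (ltW e3) mun.
      move: eps3; lra.
    by rewrite ler_pM2l //; lra.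
  have e13 : eps ^+ 3 <= eps by rewrite exprS ler_piMr ?ltW // expr2; nra.
  have pB : p * B <= n * p / 4.
    apply: (@le_trans _ _ (eps ^+ 3 / 192 * (48 * (n * p) / eps ^+ 3))).
      by apply: ler_pM => //; lra.
    rewrite le_eqVlt; apply/orP; left; apply/eqP; field; lra.
  rewrite ler_pdivrMr; last lra.
  have : (1 - p * (n - 1)) * A <= 2 * eps * A by apply: ler_wpM2r => //; lra.
  nra.
rewrite Ex_sum; apply: (@le_trans _ _ (\sum_(x : T) 2 * (n * p / (8 * eps)))).
  rewrite sumr_const -mulr_natl -[#|xpredT|]/#|T| le_eqVlt; apply/orP; left; apply/eqP.
  by field; lra.
apply: ler_sum => x _; apply: le_trans (ler_wpM2l _ (K x)) _ => //.
by rewrite -ExZ; apply: le_Ex => // E _; rewrite /deg_edges natrM mulrCA.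
Qed.

Lemma Ex_vol2_le : EE (@sum_deg_edges R T) <= 16 * mu / eps.
Proof.
have -> : 16 * mu / eps = \sum_(x : T) 2 * (8 * (n * p) / eps).
  rewrite sumr_const -mulr_natl -[#|xpredT|]/#|T|; field; exact: lt0r_neq0.
rewrite Ex_sum; apply: ler_sum => x _.
apply: le_trans _ (ler_wpM2l _ (Ex_deg_edges1 p01 T0 eps0 x)) => //.
by rewrite -ExZ; apply: le_Ex => // E _; rewrite /deg_edges natrM mulrCA.
Qed.

Lemma Ex_vol2_var :
  EE (fun E => (sum_deg_edges R E - EE (@sum_deg_edges R T)) ^+ 2) <=
  8 * 27 * 32 * mu / eps ^+ 5.
Proof.
set M := EE (@sum_deg_edges R T).
have -> : EE (fun E => (sum_deg_edges R E - M) ^+ 2) =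
    EE (fun E => sum_deg_edges R E ^+ 2) - M ^+ 2.
  transitivity (EE (fun E => sum_deg_edges R E ^+ 2 -
      (2 * M * sum_deg_edges R E - M ^+ 2))).
    by apply: eq_Ex => E _; ring.
  by rewrite ExB ExB ExZ Ex_cst -/M; ring.
rewrite lerBlDl; apply: le_trans (Ex_sum_deg_edges_sqr T p01') _.
rewrite lerD2l.
have -> : 8 * 27 * 32 * mu / eps ^+ 5 = \sum_(x : T) 8 * (27 * 32 * (n * p) / eps ^+ 5).
  rewrite sumr_const -mulr_natl -[#|xpredT|]/#|T|; field; exact: lt0r_neq0.
apply: ler_sum => x _.
apply: le_trans _ (ler_wpM2l _ (Ex_deg_edges3 p01 T0 eps0 x)) => //.
by rewrite -ExZ; apply: le_Ex => // E _; rewrite natrM exprMn; lra.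
Qed.

Lemma prob_vol2 :
  gnp_prob p (fun G : graph T =>
    ~~ (mu / (8 * eps) <= vol2 G R <= 24 * mu / eps)) <=
  (8 * 27 * 32 * 64) / (mu * eps ^+ 3).
Proof.
have e0 := eps0; have m0 := mu0; have h1 := Ex_vol2_ge; have h2 := Ex_vol2_le.
have hv := Ex_vol2_var; set M := EE (@sum_deg_edges R T) in h1 h2 hv.
have M0 : 0 < M by apply: lt_le_trans h1; rewrite divr_gt0 // mulr_gt0.
apply: le_trans (gnp_prob_le p01' (F := fun E =>
  (M ^+ 2 / 4)^-1 * (sum_deg_edges R E - M) ^+ 2) _ _) _.
- by move=> E; rewrite mulr_ge0 ?sqr_ge0 // invr_ge0 divr_ge0 ?sqr_ge0.
- move=> G hG; rewrite sum_deg_edgesE [leRHS]mulrC ler_pdivlMr ?mul1r; last first.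
    by rewrite divr_gt0 ?exprn_gt0.
  move: hG; move: (vol2 G R) => X; apply: contraR; rewrite -ltNge => hX.
  have hl : mu / (8 * eps) = mu / (4 * eps) / 2 by field; lra.
  have hu : 24 * mu / eps = 3 / 2 * (16 * mu / eps) by field; lra.
  rewrite hl hu; move: h1 h2.
  move: (mu / (4 * eps)) (16 * mu / eps) => a b h1 h2.
  clear - h1 h2 hX M0; by apply/andP; split; nra.
rewrite ExZ [leLHS]mulrC ler_pdivrMr; last by rewrite divr_gt0 ?exprn_gt0.
apply: le_trans hv _.
have : (mu / (4 * eps)) ^+ 2 <= M ^+ 2.
  have ab0 : 0 < mu / (4 * eps) by rewrite divr_gt0 // mulr_gt0.
  by rewrite lerXn2r ?nnegrE ?(ltW M0) ?(ltW ab0).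
have c0 : 0 <= (8 * 27 * 32 * 64) / (mu * eps ^+ 3) / 4.
  apply: divr_ge0 => //; apply: divr_ge0; first by rewrite !mulr_ge0.
  by rewrite mulr_ge0 ?exprn_ge0 // ltW.
move/(ler_wpM2l c0).
have -> : (8 * 27 * 32 * 64) / (mu * eps ^+ 3) / 4 * (mu / (4 * eps)) ^+ 2 = 8 * 27 * 32 * mu / eps ^+ 5.
  by move: m0 e0; move: (n ^+ 2 * p) (1 - n * p) => u v u0 v0; field; lra.
have comm4 (a b : R) : a / 4 * b = a * (b / 4) by rewrite mulrAC mulrA.
by rewrite comm4.
Qed.

Lemma nb_edges_quarter :
  gnp_prob p (fun G : graph T => (nb_edges G)%:R <= mu / 4) <= expR (- (mu / 100)).
Proof.
have h10 := n10; have m0 := mu0.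
have h : 9 / 20 * mu <= p * (n * (n - 1) / 2).
  have [p0 p1] := andP p01.
  have : 0 <= p * (n * (n - 10)) by rewrite !mulr_ge0 ?subr_ge0 //; lra.
  lra.
apply: le_trans (gnp_prob_sub p01' _) (le_trans (nb_edges_lower T p01' (d := 1 / 5) _) _).
- by move=> G hG; apply: le_trans hG _; lra.
- lra.
- by rewrite ler_expR; lra.
Qed.

Lemma prob_subcritical_score :
  gnp_prob p (fun G : graph T =>
    ~~ [&& modularity G == mod_score G (components G) :> R,
        1 / 288 / (mu * eps) <= 1 - mod_score G (components G) &
        1 - mod_score G (components G) <= 96 / (mu * eps)]) <=
  expR (- (mu / 100)) + expR (- mu) + (8 * 27 * 32 * 64) / (mu * eps ^+ 3) +
  4 * Num.sqrt (mu / 2) * eps / (expR (eps ^+ 2 / 2 * Num.sqrt (mu / 2)) - 1).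
Proof.
have e0 := eps0; have m0 := mu0.
set k := Num.sqrt (mu / 2).
have k0 : 0 < k by rewrite sqrtr_gt0 divr_gt0.
have k2 : k ^+ 2 = mu / 2 by rewrite sqr_sqrtr // divr_ge0 // ltW.
pose P1 (G : graph T) := (nb_edges G)%:R <= mu / 4.
pose P2 (G : graph T) := 3 * mu <= (nb_edges G)%:R.
pose P3 (G : graph T) := ~~ (mu / (8 * eps) <= vol2 G R <= 24 * mu / eps).
pose P4 (G : graph T) := [exists x, k <= (edges_in G (component G x))%:R].
apply: (@le_trans _ _ (gnp_prob p (predU (predU (predU P1 P2) P3) P4))); last first.
  apply: le_trans (gnp_probU p01' _ _) _; apply: lerD; last first.
    apply: le_trans (prob_large_component p01 T0 eps0 k0) _.
    rewrite le_eqVlt; apply/orP; left; apply/eqP.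
    have th0 : 0 < eps ^+ 2 / 2 * k by rewrite mulr_gt0 // divr_gt0 ?exprn_gt0.
    have := expR_sub1_lin (eps ^+ 2 / 2 * k); move: (expR _ - 1) => a ha.
    have -> : 2 * n * (n * p) * eps = 4 * k ^+ 2 * eps by rewrite k2; field.
    by field; lra.
  apply: le_trans (gnp_probU p01' _ _) _; apply: lerD; last exact: prob_vol2.
  apply: le_trans (gnp_probU p01' _ _) _; apply: lerD; first exact: nb_edges_quarter.
  exact: nb_edges_upper.
apply: gnp_prob_sub => // G; apply: contraR; rewrite !negb_or -!ltNge negbK.
case/andP=> /andP[/andP[h1 h2] /andP[h3 h4]] h5.
have nb0 : (0 < nb_edges G)%N by rewrite -(ltr0n R); lra.
have mc : modularity G = mod_score G (components G) :> R.
  apply: modularity_components => x; rewrite -(ler_nat R) natrX natrM.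
  move/existsPn: h5 => /(_ x); rewrite -ltNge => h5.
  have : (edges_in G (component G x))%:R ^+ 2 <= k ^+ 2.
    by apply: lerXn2r; rewrite ?nnegrE // ltW.
  rewrite k2; lra.
rewrite mc eqxx /= mod_score_components //.
have nb2 : 0 < 4 * (nb_edges G)%:R ^+ 2 :> R by rewrite mulr_gt0 ?exprn_gt0 ?ltr0n.
have hl : 1 / 288 / (mu * eps) = mu / (8 * eps) / (4 * (3 * mu) ^+ 2).
  by move: m0 e0; move: (n ^+ 2 * p) (1 - n * p) => u v u0 v0; field; lra.
have hu : 96 / (mu * eps) = 24 * mu / eps / (4 * (mu / 4) ^+ 2).
  by move: m0 e0; move: (n ^+ 2 * p) (1 - n * p) => u v u0 v0; field; lra.
have d3 : 0 < 4 * (3 * mu) ^+ 2 by rewrite pmulr_rgt0 // exprn_gt0 //; lra.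
have d4 : 0 < 4 * (mu / 4) ^+ 2 by rewrite pmulr_rgt0 // exprn_gt0 //; lra.
rewrite hl hu; apply/andP; split.
  apply: ler_pM => //.
  - by apply: ltW; rewrite divr_gt0 // mulr_gt0.
  - by rewrite invr_ge0 mulr_ge0 ?sqr_ge0.
  rewrite lef_pV2 ?posrE //.
  by rewrite ler_wpM2l //; apply: lerXn2r; rewrite ?nnegrE //; lra.
apply: ler_pM => //.
- by apply: le_trans h3; apply: ltW; rewrite divr_gt0 // mulr_gt0.
- by rewrite invr_ge0 ltW.
rewrite lef_pV2 ?posrE //.
by rewrite ler_wpM2l //; apply: lerXn2r; rewrite ?nnegrE //; lra.
Qed.

End SubcriticalVolume.

(** * The supercritical regime *)

Section LargeComponents.
Variables (T : finType) (G : graph T) (K : nat).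

Definition large : {set T} := [set x | (K <= #|component G x|)%N]%SET.

Definition large_roots : {set T} := [set x in large | fingraph.root (adj G) x == x]%SET.

Lemma card_large_roots : (#|large_roots| * K <= #|T|)%N.
Proof.
apply: (@leq_trans (\sum_(r in large_roots) #|component G r|)).
  by rewrite -sum_nat_const; apply: leq_sum => r; rewrite !inE => /andP[].
rewrite -[leqRHS]sum1_card.
under eq_bigr do rewrite -sum1_card.
rewrite (exchange_big_dep predT) //=; apply: leq_sum => x _.
rewrite (eq_bigl (fun r => (r \in large_roots) && (r == fingraph.root (adj G) x))); last first.
  move=> r; case: (boolP (r \in large_roots)) => //=; rewrite inE => /andP[_ /eqP rr].
  rewrite mem_component; apply/idP/eqP => [rx|->].
    by rewrite -rr; apply/eqP; rewrite root_connect //; exact: adj_csym.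
  by rewrite (adj_csym G) connect_root.
case: (boolP (fingraph.root (adj G) x \in large_roots)) => h.
  by rewrite (bigD1 (fingraph.root (adj G) x)) /= ?h ?eqxx // big1 // => r /andP[/andP[_ ->]].
by rewrite big1 // => r /andP[rl /eqP rx]; rewrite -rx rl in h.
Qed.

Lemma reach_large_roots : reach (edges G) [set: T]%SET large_roots = large.
Proof.
have lk : link (edges G) [set: T]%SET =2 adj G by move=> a b; rewrite linkE !in_setT.
apply/setP => x; apply/reachP/idP => [[r]|].
  rewrite inE => /andP[rl _]; rewrite (eq_connect lk) -mem_component => xr.
  by move: rl; rewrite !inE (component_eq xr).
move=> xl; have cr := connect_root (adj G) x.
exists (fingraph.root (adj G) x); last by rewrite (eq_connect lk) adj_csym.
rewrite !inE root_root ?eqxx ?andbT; last exact: adj_csym.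
rewrite (@component_eq _ _ x) ?mem_component //; by rewrite inE in xl.
Qed.

Lemma volume_large : volume G large = (2 * edges_in G large)%N.
Proof.
rewrite volume_cut /edge_cut big1 ?addn0 // => y yl; apply/eqP; rewrite cards_eq0.
apply/eqP/setP => z; rewrite [RHS]inE inE in_setC; apply/negP => /andP[/negP zx yz].
have yzc : z \in component G y by apply: component_adj yz; exact: component_refl.
by apply: zx; move: yl; rewrite !inE (component_eq yzc).
Qed.

Lemma volume_small x : x \notin large -> (volume G (component G x) <= K ^ 2)%N.
Proof.
rewrite inE -ltnNge => /ltnW xK; rewrite volume_component -sum_indeg.
apply: (@leq_trans (\sum_(y in component G x) K)); last first.
  by rewrite sum_nat_const -mulnn leq_mul2r xK orbT.
apply: leq_sum => y _; apply: leq_trans xK; apply: subset_leq_card.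
by apply/subsetP => z; rewrite [z \in finset _]inE => /andP[].
Qed.

Lemma vol2_large (R : realType) :
  vol2 G R <= (2 * edges_in G large)%:R ^+ 2 + (K ^ 2)%:R * (2 * nb_edges G)%:R.
Proof.
rewrite vol2E (bigID (mem large)) /=; apply: lerD.
  rewrite -volume_large.
  have -> : (volume G large)%:R ^+ 2 =
      \sum_(x in large) (degree G x)%:R * (volume G large)%:R :> R.
    by rewrite -mulr_suml -natr_sum expr2.
  apply: ler_sum => x xl; rewrite ler_wpM2l // ler_nat /volume.
  rewrite [leqRHS](big_setID (component G x)) /= (setIidPr _) ?leq_addr //.
  by apply/subsetP => y yx; move: xl; rewrite !inE (component_eq yx).
rewrite -sum_degree natr_sum mulr_sumr [leRHS](bigID (mem large)) /= -[leLHS]add0r.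
apply: lerD; first by apply: sumr_ge0 => x _; rewrite mulr_ge0.
by apply: ler_sum => x xl; rewrite mulrC ler_wpM2r // ler_nat volume_small.
Qed.

End LargeComponents.

Section Supercritical.
Variables (R : realType) (T : finType) (p : R).
Local Notation n := (#|T|%:R : R).
Local Notation lam := (n * p).
Hypothesis p01 : 0 <= p <= 1.
Local Notation reachT G A := (reach (edges G) [set: T]%SET A).

Lemma prob_reach_ge (h : R) (A : {set T}) (s : nat) : 0 <= h <= 1 / 2 ->
  gnp_prob p (fun G => (s <= #|reachT G A|)%N) <=
  expR (h * (#|A|%:R - s%:R) + n * (h + 2 * h ^+ 2) * (1 - (1 - p) ^+ s)).
Proof.
have [p0 p1] := andP p01; move=> /andP[h0 h1].
have th1 : 1 <= expR h by have := expR_ge1Dx h; lra.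
have thu : expR h - 1 <= h + 2 * h ^+ 2 by apply: expR_sub1_le; rewrite h0 h1.
apply: le_trans (gnp_prob_le p01 (F := fun E => (s <= #|reach E [set: T]%SET A|)%N%:R) _ _) _.
- by move=> E.
- by move=> G ->.
have := Ex_reach_tail p01 s th1 (subsetT A).
set X := Ex _ _ _; set q := 1 - (1 - p) ^+ s => hX.
have q0 : 0 <= q by rewrite subr_ge0 exprn_ile1 //; lra.
have -> : X = expR (- (h * s%:R)) * (expR h ^+ s * X).
  by rewrite -expRM_natr mulrA -expRD addNr expR0 mul1r.
apply: le_trans (ler_wpM2l (expR_ge0 _) hX) _.
have -> : h * (#|A|%:R - s%:R) + n * (h + 2 * h ^+ 2) * q =
  - (h * s%:R) + (h * #|A|%:R + n * ((h + 2 * h ^+ 2) * q)) by ring.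
rewrite expRD ler_wpM2l ?expR_ge0 // expRD -[expR h ^+ _]expRM_natr.
rewrite ler_wpM2l ?expR_ge0 //.
have a0 : 0 <= (expR h - 1) * q by rewrite mulr_ge0 //; lra.
apply: le_trans (expR_pow_le _ _) _; first by lra.
rewrite ler_expR; apply: ler_pM => //; last by rewrite ler_wpM2r.
by rewrite ler_nat max_card.
Qed.

Lemma prob_edges_ge (h b : R) (A : {set T}) (s : nat) : 0 <= h <= 1 / 2 ->
  (s <= #|T|)%N ->
  gnp_prob p (fun G => (#|reachT G A| <= s)%N &&
     (b <= (edges_in G (reachT G A))%:R)) <=
  expR (- (h * b) + (n * s%:R - s%:R ^+ 2 / 2) * (p * (h + 2 * h ^+ 2))).
Proof.
have [p0 p1] := andP p01; move=> /andP[h0 h1] sT.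
have th1 : 1 <= expR h by have := expR_ge1Dx h; lra.
have thu : expR h - 1 <= h + 2 * h ^+ 2 by apply: expR_sub1_le; rewrite h0 h1.
apply: le_trans (gnp_prob_le p01 (F := fun E => expR (- (h * b)) *
   ((#|reach E [set: T]%SET A| <= s)%N%:R *
    expR h ^+ edges_within E (reach E [set: T]%SET A))) _ _) _.
- by move=> E; rewrite !mulr_ge0 ?expR_ge0 ?exprn_ge0 ?expR_ge0.
- move=> G /andP[-> hb]; rewrite mul1r -expRM_natr -expRD -[leLHS]expR0 ler_expR.
  by have := ler_wpM2l h0 hb; rewrite /edges_in /edges_within; lra.
rewrite ExZ expRD ler_wpM2l ?expR_ge0 //.
apply: le_trans (Ex_edges_tail p01 s th1 (subsetT A)) _.
have a0 : 0 <= p * (expR h - 1) by rewrite mulr_ge0 //; lra.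
apply: le_trans (expR_pow_le _ _) _; first by lra.
rewrite ler_expR cardsT; apply: ler_pM => //; last by rewrite ler_wpM2l.
have [n0|n0] := posnP #|T|.
  by move: sT; rewrite n0 leqn0 => /eqP ->; rewrite big_ord0 expr0n /=; lra.
elim: s sT => [_|s IH sT]; first by rewrite big_ord0 expr0n /=; lra.
rewrite big_ord_recr natrD /= natrB; last by rewrite -ltnS prednK.
have := IH (ltnW sT); rewrite -subn1 natrB // -[s.+1]addn1 natrD; lra.
Qed.

(* The sum over all sets is (1 + e^(- t))^n, read off Ex_pow2 at p = 1/2. *)
Lemma count_small_sets (t : R) (K : nat) : 0 <= t ->
  \sum_(A : {set T} | (#|A| * K <= #|T|)%N) expR (- (t * #|A|%:R)) <=
  expR (n * expR (- t)).
Proof.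
move=> t0; have := Ex_pow2 (1 / 2 : R) [set: T]%SET (2 * expR (- t)) 2.
rewrite cardsT.
have -> : 1 / 2 * (2 * expR (- t)) + (1 - 1 / 2) * 2 = 1 + expR (- t) by field.
move=> e; apply: le_trans (expR_pow_le _ _); last first.
  by have := expR_ge0 (- t); lra.
rewrite -e /Ex [leRHS](bigID (fun A : {set T} => (#|A| * K <= #|T|)%N)) /=.
rewrite -[leLHS]addr0 lerD //; last first.
  apply: sumr_ge0 => B _; rewrite !mulr_ge0 ?exprn_ge0 ?mulr_ge0 ?expR_ge0 //; lra.
rewrite [leRHS](eq_bigl (fun A : {set T} => (#|A| * K <= #|T|)%N)); last first.
  by move=> A; rewrite subsetT.
apply: ler_sum => A _.
rewrite mulrACA -!exprMn.
have -> : 1 / 2 * (2 * expR (- t)) = expR (- t) by field.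
have -> : (1 - 1 / 2) * 2 = 1 :> R by field.
by rewrite expr1n mulr1 -expRM_natr mulNr.
Qed.

End Supercritical.

Section SupercriticalScore.
Variables (R : realType) (T : finType) (p eps : R) (K s : nat).
Local Notation n := (#|T|%:R : R).
Local Notation lam := (n * p).
Local Notation reachT G A := (reach (edges G) [set: T]%SET A).
Local Notation gam := (eps ^+ 6 / 64).
Local Notation b := ((2 * eps - eps ^+ 2) * (n * p) * n).
Hypotheses (p01 : 0 <= p <= 1) (eps0 : 0 < eps <= 1 / 4).
Hypothesis lam1 : 1 <= lam <= 1 + eps.
Hypotheses (K1 : 8 <= K%:R * eps ^+ 3) (K2 : 4 <= K%:R * gam ^+ 2).
Hypotheses (n1 : 16 <= n * eps ^+ 3) (n2 : K%:R ^+ 2 < n * eps ^+ 3).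
Hypothesis sn : 2 * eps * n <= s%:R <= 2 * eps * n + 1.

Let e2 : eps ^+ 2 <= eps / 4.
Proof. by move: eps0 => /andP[h1 h2]; rewrite expr2; nra. Qed.

Let e20 : 0 < eps ^+ 2.
Proof. by rewrite exprn_gt0 //; case/andP: eps0. Qed.

Let e3 : eps ^+ 3 <= eps ^+ 2 / 4.
Proof. by move: eps0 => /andP[h1 h2]; rewrite exprS; nra. Qed.

Let e30 : 0 < eps ^+ 3.
Proof. by rewrite exprn_gt0 //; case/andP: eps0. Qed.

Let ne2 : 16 <= n * eps ^+ 2.
Proof. by have := n1; have := ler_wpM2l (ler0n R #|T|) e3; lra. Qed.

Let ne1 : 16 <= n * eps.
Proof. by have := ne2; have := ler_wpM2l (ler0n R #|T|) e2; lra. Qed.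

Let n0 : 64 <= n.
Proof. by have := ne1; move: eps0 => /andP[h1 h2]; have := ler_wpM2l (ler0n R #|T|) h2; lra. Qed.

(* With c = 1 + eps, the fraction 2 eps exceeds the survival probability of the
   Poisson(c) branching process, the positive root of b = 1 - e^(- c b). *)
Lemma survival_gap : 1 - 2 * eps + eps ^+ 3 <= expR (- (2 * eps * (1 + eps))).
Proof.
move: eps0 => /andP[h1 h2].
have x0 : 0 <= 2 * eps * (1 + eps) by rewrite !mulr_ge0 //; lra.
apply: le_trans _ (expRN_taylor3 x0); rewrite -subr_ge0.
set P := (X in 0 <= X).
have -> : P = eps ^+ 3 * (3 + 2 * eps - 4 / 3 * (1 + eps) ^+ 3) by rewrite /P; field.
rewrite mulr_ge0 ?(ltW e30) //.
have : (1 + eps) ^+ 3 <= (5 / 4) ^+ 3 by rewrite lerXn2r ?nnegrE //; lra.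
lra.
Qed.

Lemma reach_rate : 1 - (1 - p) ^+ s <= 2 * eps - eps ^+ 3 / 2.
Proof.
have [p0 p1] := andP p01; have [h1 h2] := andP eps0; have [l1 l2] := andP lam1.
have [s1 s2] := andP sn; have hn := n0.
have pn : p <= 2 / n by rewrite ler_pdivlMr; lra.
have n2' : 2 / n <= 1 / 2 by rewrite ler_pdivrMr; lra.
have pp : expR (- (p / (1 - p))) <= 1 - p.
  have x0 : 0 < 1 - p by lra.
  rewrite expRN -[leRHS]invrK lef_pV2 ?posrE ?invr_gt0 ?expR_gt0 //.
  apply: le_trans _ (expR_ge1Dx _); rewrite le_eqVlt; apply/orP; left; apply/eqP.
  by field; lra.
have : expR (- (p / (1 - p))) ^+ s <= (1 - p) ^+ s.
  by rewrite lerXn2r ?nnegrE ?expR_ge0 //; lra.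
rewrite -expRM_natr mulNr => hs.
suff : 1 - 2 * eps + eps ^+ 3 / 2 <= expR (- (p / (1 - p) * s%:R)) by lra.
pose x0 := 2 * eps * (1 + eps).
have x01 : x0 <= 1 by rewrite /x0; nra.
have x00 : 0 <= x0 by rewrite /x0; nra.
have hx : p / (1 - p) * s%:R <= x0 + 8 / n.
  rewrite mulrAC ler_pdivrMr; last lra.
  have ps : p * s%:R <= x0 + 2 / n.
    have : p * s%:R <= p * (2 * eps * n + 1) by rewrite ler_wpM2l.
    have : 2 * eps * lam <= x0 by rewrite /x0 ler_wpM2l //; lra.
    lra.
  have : (x0 + 8 / n) * (1 - 2 / n) <= (x0 + 8 / n) * (1 - p).
    by rewrite ler_wpM2l; [|rewrite addr_ge0 // divr_ge0|]; lra.
  apply: le_trans; apply: le_trans ps _.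
  have u0 : 0 <= n^-1 by rewrite invr_ge0.
  have u1 : n^-1 <= 1 / 4 by lra.
  by move: (n^-1) u0 u1 x00 x01 => u; nra.
have h8 : 8 / n <= eps ^+ 3 / 2 by rewrite ler_pdivrMr; have := n1; lra.
apply: (@le_trans _ _ (expR (- (x0 + 8 / n)))); last by rewrite ler_expR lerN2.
rewrite opprD expRD.
have hg := survival_gap; rewrite -/x0 in hg.
have := expR_ge1Dx (- (8 / n)); have e1 : expR (- x0) <= 1 by rewrite expR_le1; lra.
have ex0 := expR_ge0 (- x0).
have u0 : 0 <= 8 / n by rewrite divr_ge0.
move/(ler_wpM2l ex0); apply: le_trans.
by move: (expR (- x0)) (8 / n) hg h8 e1 ex0 u0 => y u; nra.
Qed.

Definition overgrown (A : {set T}) (G : graph T) : bool :=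
  (s <= #|reachT G A|)%N ||
  ((#|reachT G A| <= s)%N && (b <= (edges_in G (reachT G A))%:R)).

Lemma prob_overgrown (A : {set T}) : (#|A| * K <= #|T|)%N ->
  gnp_prob p (overgrown A) <= 2 * expR (- (2 * n * gam)).
Proof.
move=> AK; have [p0 p1] := andP p01; have [h1 h2] := andP eps0.
have [l1 l2] := andP lam1; have [s1 s2] := andP sn; have hn := n0.
have AKR : #|A|%:R * K%:R <= n by rewrite -natrM ler_nat.
have A0 : 0 <= #|A|%:R :> R by [].
apply: le_trans (gnp_probU p01 _ _) _.
rewrite [leRHS]mulr_natl mulr2n; apply: lerD.
  have hh : 0 <= eps ^+ 3 / 8 <= 1 / 2 by have := e30; have := e3; have := e2; lra.
  apply: le_trans (prob_reach_ge p01 A s hh) _; rewrite ler_expR.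
  have A8 : #|A|%:R <= n * eps ^+ 3 / 8.
    have := ler_wpM2l A0 K1; have := ler_wpM2r (ltW e30) AKR; lra.
  have c0 : 0 <= n * (eps ^+ 3 / 8 + 2 * (eps ^+ 3 / 8) ^+ 2).
    have [g0 _] := andP hh.
    by rewrite mulr_ge0 // addr_ge0 // mulr_ge0 // sqr_ge0.
  have := ler_wpM2l c0 reach_rate.
  set q := 1 - _; move: q => q hq.
  have g0 : 0 <= eps ^+ 3 / 8 by case/andP: hh.
  have hA : eps ^+ 3 / 8 * (#|A|%:R - s%:R) <= eps ^+ 3 / 8 * (n * eps ^+ 3 / 8 - 2 * eps * n).
    by rewrite ler_wpM2l //; lra.
  apply: le_trans (lerD hA hq) _.
  rewrite -subr_ge0.
  set P := (X in 0 <= X).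
  have -> : P = n * (eps ^+ 6 / 64) * (1 - 4 * eps + eps ^+ 3) by rewrite /P; field.
  apply: mulr_ge0; last by have := e30; lra.
  by rewrite mulr_ge0 // divr_ge0 // exprn_ge0 // ltW.
have hh : 0 <= eps / 16 <= 1 / 2 by lra.
have sT : (s <= #|T|)%N.
  rewrite -(ler_nat R); have := ler_wpM2l (ler0n R #|T|) h2; lra.
apply: le_trans (prob_edges_ge p01 b A hh sT) _; rewrite ler_expR.
have hs : n * s%:R - s%:R ^+ 2 / 2 <= n ^+ 2 * (2 * eps - 2 * eps ^+ 2) + n.
  have : n * s%:R <= n * (2 * eps * n + 1) by rewrite ler_wpM2l.
  have : (2 * eps * n) ^+ 2 <= s%:R ^+ 2.
    by rewrite lerXn2r ?nnegrE // !mulr_ge0 //; lra.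
  rewrite !expr2; lra.
have c0 : 0 <= p * (eps / 16 + 2 * (eps / 16) ^+ 2).
  by rewrite mulr_ge0 // addr_ge0 ?mulr_ge0 ?sqr_ge0 //; lra.
apply: (@le_trans _ _ (- (eps / 16 * b) +
  (n ^+ 2 * (2 * eps - 2 * eps ^+ 2) + n) * (p * (eps / 16 + 2 * (eps / 16) ^+ 2)))).
  by rewrite lerD2l ler_wpM2r.
have -> : - (eps / 16 * b) +
  (n ^+ 2 * (2 * eps - 2 * eps ^+ 2) + n) * (p * (eps / 16 + 2 * (eps / 16) ^+ 2)) =
  - (lam * (eps / 16)) * (n * eps ^+ 2 * (3 / 4 + eps / 4) - 1 - eps / 8).
  by field.
have hx : n * eps ^+ 2 / 2 <= n * eps ^+ 2 * (3 / 4 + eps / 4) - 1 - eps / 8.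
  have := ne2; have : 0 <= n * eps ^+ 2 * eps by rewrite !mulr_ge0 ?(ltW e20) //; lra.
  lra.
have hl : eps / 16 <= lam * (eps / 16) by rewrite ler_peMl //; lra.
have : eps / 16 * (n * eps ^+ 2 / 2) <= lam * (eps / 16) *
    (n * eps ^+ 2 * (3 / 4 + eps / 4) - 1 - eps / 8).
  by apply: ler_pM => //; have := ne2; lra.
have : n * eps ^+ 6 <= n * eps ^+ 3.
  rewrite ler_wpM2l // -[6%N]/(3 + 3)%N exprD ler_piMl ?(ltW e30) //.
  by have := e3; have := e2; lra.
rewrite mulNr lerN2; move: (lam * _ * _) => X.
have -> : eps / 16 * (n * eps ^+ 2 / 2) = n * eps ^+ 3 / 32 by field.
by rewrite [(eps ^+ 6)]lock; lra.
Qed.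

Lemma prob_exists_overgrown :
  gnp_prob p (fun G => [exists A : {set T}, (#|A| * K <= #|T|)%N && overgrown A G]) <=
  2 * expR (- (n * gam)).
Proof.
apply: le_trans (gnp_prob_exists p01 _ _) _.
have g0 : 0 < gam by rewrite divr_gt0 // exprn_gt0 //; case/andP: eps0.
pose t := 2 / gam.
have t0 : 0 < t by rewrite divr_gt0.
apply: (@le_trans _ _ (\sum_(A : {set T} | (#|A| * K <= #|T|)%N)
   2 * expR (- (3 / 2 * n * gam)) * expR (- (t * #|A|%:R)))).
  apply: ler_sum => A AK; apply: le_trans (prob_overgrown AK) _.
  rewrite -[leRHS]mulrA ler_wpM2l // -expRD ler_expR.
  have AKR : #|A|%:R * K%:R <= n by rewrite -natrM ler_nat.
  have : t * #|A|%:R <= n * gam / 2.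
    have tK : t <= K%:R * gam / 2 by rewrite /t ler_pdivrMr //; move: K2; rewrite expr2; lra.
    have := ler_wpM2r (ler0n R #|A|) tK; have := ler_wpM2r (ltW g0) AKR; lra.
  lra.
rewrite -mulr_sumr -[leLHS]mulrA ler_wpM2l //.
apply: le_trans (ler_wpM2l (expR_ge0 _) (count_small_sets T K (ltW t0))) _.
rewrite -expRD ler_expR.
have : expR (- t) <= gam / 2.
  have g2 : 0 < gam / 2 by rewrite divr_gt0.
  rewrite expRN -[leRHS]invrK lef_pV2 ?posrE ?invr_gt0 ?expR_gt0 //.
  rewrite invf_div -/t; have := expR_ge1Dx t; lra.
move/(ler_wpM2l (ler0n R #|T|)); lra.
Qed.

Lemma prob_supercritical_score :
  gnp_prob p (fun G : graph T =>
    ~~ ((mod_score G (components G) <= modularity G :> R) &&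
        (1 - (4 * eps) ^+ 2 < mod_score G (components G)))) <=
  2 * expR (- (n * gam)) + expR (- ((eps / 16) ^+ 2 * ((n - 1) / 2))).
Proof.
have [p0 p1] := andP p01; have [h1 h2] := andP eps0.
have [l1 l2] := andP lam1; have hn := n0; have hne := ne1.
pose P1 (G : graph T) := [exists A : {set T}, (#|A| * K <= #|T|)%N && overgrown A G].
pose P2 (G : graph T) := (nb_edges G)%:R <= (1 - 2 * (eps / 16)) * (p * (n * (n - 1) / 2)).
apply: (@le_trans _ _ (gnp_prob p (predU P1 P2))); last first.
  apply: le_trans (gnp_probU p01 _ _) _; apply: lerD; first exact: prob_exists_overgrown.
  apply: le_trans (nb_edges_lower T p01 (d := eps / 16) _) _; first lra.
  rewrite ler_expR lerN2 ler_wpM2l ?sqr_ge0 //.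
  have : 0 <= (n * p - 1) * (n - 1) by rewrite mulr_ge0 //; lra.
  lra.
apply: gnp_prob_sub => // G; apply: contraR; rewrite negb_or -ltNge.
case/andP=> /existsPn hA hm.
rewrite modularity_ge ?components_partition //=.
have := hA (large_roots G K); rewrite card_large_roots // /overgrown reach_large_roots //=.
rewrite negb_or -ltnNge => /andP[hs]; rewrite (ltnW hs) /= -ltNge => hb.
have := vol2_large G K R.
have hm1 : (1 - eps / 8) * (1 - eps / 16) * (lam * n / 2) < (nb_edges G)%:R.
  apply: le_lt_trans _ hm.
  have a0 : 0 <= (1 - eps / 8) * lam / 2 by rewrite !mulr_ge0 //; lra.
  have h16 : (1 - eps / 16) * n <= n - 1 by lra.
  have := ler_wpM2l a0 h16; lra.
set m : R := (nb_edges G)%:R in hm1 *.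
have hc : 1 - 3 / 16 * eps <= (1 - eps / 8) * (1 - eps / 16) by nra.
have L0 : 0 < lam * n / 2 by rewrite divr_gt0 // mulr_gt0 //; lra.
have hm2 : (1 - 3 / 16 * eps) * (lam * n / 2) < m.
  by apply: le_lt_trans _ hm1; rewrite ler_pM2r.
have m4 : n / 4 <= m.
  apply: ltW; apply: le_lt_trans _ hm2.
  have : n <= lam * n by rewrite ler_peMl.
  have : 0 <= (1 / 2 - 3 / 16 * eps) * (lam * n / 2) by rewrite mulr_ge0 ?(ltW L0) //; lra.
  lra.
have m0 : 0 < m by lra.
have nb0 : (0 < nb_edges G)%N by rewrite -(ltr0n R).
have bm : (edges_in G (large G K))%:R <= (4 * eps - eps ^+ 2) * m.
  apply: ltW; apply: lt_le_trans hb _.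
  have c0 : 0 <= 4 * eps - eps ^+ 2 by have := e2; lra.
  apply: le_trans (ler_wpM2l c0 (ltW hm2)).
  rewrite -subr_ge0.
  set P := (X in 0 <= X).
  have -> : P = lam * n / 2 * (eps ^+ 2 / 4 + 3 / 16 * eps ^+ 3) by rewrite /P; field.
  by rewrite mulr_ge0 ?(ltW L0) //; have := e20; have := e30; lra.
move=> hv.
suff : vol2 G R < (4 * eps) ^+ 2 * (4 * m ^+ 2).
  rewrite -ltr_pdivrMr ?mulr_gt0 ?exprn_gt0 // -mod_score_components //; lra.
apply: le_lt_trans hv _; rewrite natrX !natrM -/m.
have : (edges_in G (large G K))%:R ^+ 2 <= ((4 * eps - eps ^+ 2) * m) ^+ 2 :> R.
  rewrite lerXn2r ?nnegrE //; apply: le_trans bm; exact: ler0n.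
have K2m : K%:R ^+ 2 * m < 4 * m * eps ^+ 3 * m.
  rewrite ltr_pM2r //; apply: lt_le_trans n2 _.
  have := ler_wpM2r (ltW e30) m4; lra.
have : eps ^+ 4 <= eps ^+ 3 / 4.
  by rewrite exprS; have := ler_wpM2r (ltW e30) h2; lra.
move/(ler_wpM2r (sqr_ge0 m)); rewrite !exprMn.
have : 0 < eps ^+ 3 * m ^+ 2 by rewrite mulr_gt0 ?exprn_gt0.
move: ((edges_in G _)%:R ^+ 2) => X.
have -> : (4 * eps - eps ^+ 2) ^+ 2 = 16 * eps ^+ 2 - 8 * eps ^+ 3 + eps ^+ 4 by ring.
rewrite !expr2 in K2m *.
lra.
Qed.

End SupercriticalScore.

(** * The sparse regime *)

Section Matching.
Variables (R : realType) (T : finType).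

Section Deterministic.
Variable G : graph T.
Hypothesis deg1 : forall x, (degree G x <= 1)%N.

Lemma matching_volume x : (volume G (component G x) <= 2)%N.
Proof.
pose N := [set y | adj G x y]%SET.
have cN : component G x \subset x |: N.
  apply: reach_min => [|y z]; first by rewrite sub1set setU11.
  rewrite !in_setU1 => /predU1P[->|yN]; rewrite linkE => /and3P[_ _ yz].
    by rewrite inE [adj _ _ _]yz orbT.
  apply/orP; left; rewrite inE in yN.
  have /cards1P[u] : #|[set w | adj G y w]%SET| == 1%N.
    rewrite eqn_leq deg1 card_gt0; apply/set0Pn.
    by exists z; rewrite inE.
  move/setP => hu; have := hu z; have := hu x; rewrite !inE adj_sym yN [adj _ _ z]yz.
  by move=> /esym/eqP -> /esym.
have c2 : (#|component G x| <= 2)%N.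
  apply: leq_trans (subset_leq_card cN) _.
  apply: leq_trans (leq_of_leqif (leq_card_setU _ _)) _.
  by rewrite cards1 ltnS deg1.
apply: leq_trans c2; rewrite -sum1_card /volume.
by apply: leq_sum => y _; exact: deg1.
Qed.

Lemma matching_modularity : (0 < nb_edges G)%N ->
  modularity G = mod_score G (components G) :> R.
Proof.
move=> m0; apply: modularity_components => x.
have := matching_volume x; rewrite volume_component -{2}[2%N]muln1 leq_pmul2l // => h.
apply: (@leq_trans (1 ^ 2)); first by rewrite leq_sqr.
by apply: leq_trans m0 _; rewrite leq_pmull.
Qed.

Lemma matching_score : (0 < nb_edges G)%N ->
  mod_score G (components G) = 1 - 1 / (nb_edges G)%:R :> R.
Proof.
move=> m0; have m0' : (nb_edges G)%:R != 0 :> R by rewrite pnatr_eq0 -lt0n.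
suff v2 : vol2 G R = 4 * (nb_edges G)%:R.
  have := mod_score_components R m0; rewrite v2.
  have -> : 4 * (nb_edges G)%:R / (4 * (nb_edges G)%:R ^+ 2) = 1 / (nb_edges G)%:R :> R.
    by field.
  by lra.
rewrite vol2E (_ : 4 = 2 * 2) -?natrM // -mulnA natrM -sum_degree natr_sum mulr_sumr.
apply: eq_bigr => x _; rewrite mulrC.
have [->|dx] := posnP (degree G x); first by rewrite !mulr0.
congr (_%:R * _); apply/eqP; rewrite eqn_leq matching_volume volume_component.
rewrite -{1}[2%N]muln1 leq_pmul2l // -(ltn_pmul2l (isT : 0 < 2)%N) muln0.
rewrite -volume_component /volume (bigD1 x) ?component_refl //=.
by apply: leq_trans dx _; exact: leq_addr.
Qed.

End Deterministic.

Variable p : R.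
Local Notation n := (#|T|%:R : R).
Hypothesis p01 : 0 < p <= 1.

Lemma prob_degree_ge2 : 0 < n * p <= 1 ->
  gnp_prob p (fun G : graph T => [exists x, (2 <= degree G x)%N]) <=
  4 * (n ^+ 3 * p ^+ 2).
Proof.
move=> /andP[l0 l1]; have [p0 p1] := andP p01.
have p01' : 0 <= p <= 1 by lra.
apply: (@le_trans _ _ (\sum_(x : T) 4 * (n * p) ^+ 2)); last first.
  rewrite sumr_const -mulr_natl -[#|xpredT|]/#|T| le_eqVlt; apply/orP; left; apply/eqP.
  by ring.
apply: le_trans (gnp_prob_exists p01' predT (fun x G => 2 <= degree G x)%N) _.
apply: ler_sum => x _; pose w := (n * p)^-1.
have w1 : 1 <= w by rewrite invf_ge1.
have w0 : 0 < w by lra.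
apply: le_trans (gnp_prob_le p01' (F := fun E =>
  (n * p) ^+ 2 * w ^+ #|nbr E [set: T]%SET x|) _ _) _.
- by move=> E; rewrite mulr_ge0 ?exprn_ge0 // ltW.
- move=> G hG; rewrite -degree_nbr -[leLHS](_ : (n * p) ^+ 2 * w ^+ 2 = 1).
    by rewrite ler_wpM2l ?sqr_ge0 // ler_weXn2l.
  by rewrite -exprMn mulfV ?expr1n // lt0r_neq0.
rewrite ExZ mulrC ler_wpM2r ?sqr_ge0 //.
rewrite (Ex_nbr p (fun N : {set T} => w ^+ #|N|) (in_setT x)) Ex_pow.
have a0 : 0 <= p * (w - 1) by rewrite mulr_ge0 //; lra.
apply: le_trans (expR_pow_le _ _) _; first by lra.
apply: le_trans _ (expR1_le4 R); rewrite ler_expR cardT_D1.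
have : n * p * w = 1 by rewrite mulfV // lt0r_neq0.
have n0 : 0 <= n by [].
have : p <= p * w by rewrite ler_peMr // ltW.
have : 0 <= n * p by lra.
lra.
Qed.

End Matching.

From mathcomp Require Import all_classical all_reals all_analysis.
Local Open Scope classical_set_scope.

(** * Asymptotics *)

Section Asymptotics.
Variable R : realType.

Lemma expRN_le (x : R) : 0 < x -> expR (- x) <= x^-1.
Proof.
move=> x0; rewrite expRN lef_pV2 ?posrE ?expR_gt0 //.
by have := expR_ge1Dx x; lra.
Qed.

Lemma whpP (p : nat -> R) (E : forall n, pred (graph 'I_n)) :
  (forall n, 0 < p n <= 1) ->
  (forall eta : R, 0 < eta -> \forall n \near \oo,
     gnp_prob (p n) (fun G : graph 'I_n => ~~ E n G) <= eta) -> whp p E.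
Proof.
move=> hp hE; apply/cvgrPdist_le => eta eta0.
have := hE eta eta0; apply: filter_app; near=> n => h.
have p01 : 0 <= p n <= 1 by have := hp n; lra.
by rewrite (gnp_probC (p n) (E n)) opprB addrCA subrr addr0 ger0_norm ?gnp_prob_ge0.
Unshelve. all: by end_near.
Qed.

Lemma near_nat_ge (A : R) : \forall n \near \oo, A <= n%:R :> R.
Proof. exact: nbhs_infty_ger. Qed.

Lemma near_ln_ge (A : R) : \forall n \near \oo, A <= ln n%:R :> R.
Proof.
have := near_nat_ge (expR A); apply: filterS => n h.
have n0 : 0 < n%:R :> R by apply: lt_le_trans h; exact: expR_gt0.
by rewrite -[leLHS]expRK ler_ln ?posrE ?expR_gt0.
Qed.

Lemma ratio_far (A c eps k : R) : 0 < A -> 0 < c <= eps ^+ 2 / 2 ->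
  0 < eps <= 1 -> 0 < k -> 12 * A <= c * c * k ->
  4 * k * eps / (expR (eps ^+ 2 / 2 * k) - 1) <= A^-1.
Proof.
move=> A0 /andP[c0 ce] /andP[eps0 eps1] k0 kA.
have hk : c * k <= eps ^+ 2 / 2 * k by rewrite ler_pM2r.
have ck0 : 0 < c * k by rewrite mulr_gt0.
move: (eps ^+ 2 / 2 * k) hk => y hk {ce}.
have y0 : 0 < y := lt_le_trans ck0 hk.
have hexp := expR_sub1_sqr (ltW y0).
have den0 : 0 < expR y - 1 by rewrite subr_gt0 expR_gt1.
have h1 : (c * k) ^+ 2 <= y ^+ 2 by rewrite lerXn2r ?nnegrE // ltW.
have h3 : 12 * A * k <= (c * k) ^+ 2.
  by have := ler_wpM2r (ltW k0) kA; rewrite !expr2; lra.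
have h4 : 12 * A * k <= 3 * (expR y - 1) := le_trans h3 (le_trans h1 hexp).
rewrite ler_pdivrMr // [leRHS]mulrC ler_pdivlMr //.
have : k * eps * A <= k * A by rewrite ler_pM2r // ler_piMr // ltW.
lra.
Qed.

Lemma quadratic_le_expR (A s : R) : 0 <= s -> (60 * A) ^+ 2 <= s ->
  32 * A ^+ 2 * s <= expR (s / 6).
Proof.
move=> s0 hs; have y0 : 0 <= s / 6 by lra.
have := expR_sub1_sqr y0; have : (60 * A) ^+ 2 * s <= s * s by rewrite ler_wpM2r.
move: (expR _) => y; have : 0 <= A ^+ 2 * s by rewrite mulr_ge0 ?sqr_ge0.
by rewrite !expr2; lra.
Qed.

Lemma ratio_near (A eps k r : R) : 1 <= A -> 0 < eps -> 0 < k -> 0 < r ->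
  r * (2 / 3) <= k -> k ^+ 2 <= r ^+ 2 / 2 -> r <= expR (eps ^+ 2 * r / 2) ->
  (60 * A) ^+ 2 <= eps ^+ 2 * r ->
  4 * k * eps / (expR (eps ^+ 2 / 2 * k) - 1) <= A^-1.
Proof.
move=> A1 eps0 k0 r0 kr k2 rs hA; have A0 : 0 < A by lra.
have s3 : 3 <= eps ^+ 2 * r.
  apply: le_trans hA; rewrite exprMn; have : 1 <= A ^+ 2 by rewrite exprn_ege1.
  lra.
have ths : eps ^+ 2 * r / 3 <= eps ^+ 2 / 2 * k.
  have -> : eps ^+ 2 * r / 3 = eps ^+ 2 / 2 * (r * (2 / 3)) by field.
  by rewrite ler_wpM2l // divr_ge0 // sqr_ge0.
have ke : (k * eps) ^+ 2 <= r * (eps ^+ 2 * r) / 2.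
  have := ler_wpM2r (sqr_ge0 eps) k2; rewrite exprMn.
  by rewrite (_ : r * _ / 2 = r ^+ 2 / 2 * eps ^+ 2) //; ring.
have hexp := quadratic_le_expR (le_trans (ler0n _ 3) s3) hA.
move: (eps ^+ 2 * r) s3 ths ke rs hexp => s s3 ths ke rs hexp {hA kr k2}.
have s0 : 0 <= s by lra.
have den : expR (s / 3) / 2 <= expR (eps ^+ 2 / 2 * k) - 1.
  have h1 : expR (s / 3) <= expR (eps ^+ 2 / 2 * k) by rewrite ler_expR.
  have := expR_ge1Dx (s / 3); lra.
have den0 : 0 < expR (eps ^+ 2 / 2 * k) - 1.
  by apply: lt_le_trans den; rewrite divr_gt0 // expR_gt0.
rewrite ler_pdivrMr // [leRHS]mulrC ler_pdivlMr //; apply: le_trans den.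
rewrite -(@ler_pXn2r _ 2) ?nnegrE ?divr_ge0 ?expR_ge0 //; last first.
  by rewrite !mulr_ge0 // ltW.
have -> : (4 * k * eps * A) ^+ 2 = 16 * A ^+ 2 * (k * eps) ^+ 2 by ring.
have -> : (expR (s / 3) / 2) ^+ 2 = expR (s / 2) * expR (s / 6) / 4.
  have -> : (expR (s / 3) / 2) ^+ 2 = expR (s / 3) ^+ 2 / 4 by field.
  by rewrite -expRM_natl -expRD; congr (expR _ / 4); field.
apply: (@le_trans _ _ (16 * A ^+ 2 * (expR (s / 2) * s / 2))).
  apply: ler_wpM2l; first by rewrite mulr_ge0 // sqr_ge0.
  apply: le_trans ke _.
  by rewrite ler_pM2r // ler_wpM2r.
have := ler_wpM2l (expR_ge0 (s / 2)) hexp; lra.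
Qed.

Lemma subcritical_error (n : nat) (p A : R) : (10 <= n)%N -> 0 < p ->
  1 <= A -> (60 * A) ^+ 2 <= ln n%:R -> 0 < 1 - n%:R * p ->
  2 * (20 * (20 * (10 * (10 * (12 * A))))) ^+ 2 <= n%:R ^+ 2 * p ->
  ln n%:R <= (1 - n%:R * p) ^+ 2 * Num.sqrt n%:R ->
  A <= n%:R ^+ 2 * p * (1 - n%:R * p) ^+ 3 /\
  4 * Num.sqrt (n%:R ^+ 2 * p / 2) * (1 - n%:R * p) /
  (expR ((1 - n%:R * p) ^+ 2 / 2 * Num.sqrt (n%:R ^+ 2 * p / 2)) - 1) <= A^-1.
Proof.
move=> n10 p0 A1; have n0 : 0 < n%:R :> R by rewrite ltr0n (leq_trans _ n10).
have muE : n%:R ^+ 2 * p = n%:R * (1 - (1 - n%:R * p)) by ring.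
have mu0 : 0 < n%:R ^+ 2 * p by rewrite mulr_gt0 // exprn_gt0.
have : 1 - n%:R * p < 1 by have := mulr_gt0 n0 p0; lra.
move: (1 - n%:R * p) (n%:R ^+ 2 * p) mu0 muE => eps mu mu0 muE eps1 hL eps0 hmu hs.
have A0 : 0 <= A by lra.
have k2 : Num.sqrt (mu / 2) ^+ 2 = mu / 2 by rewrite sqr_sqrtr // divr_ge0 // ltW.
have k0 : 0 < Num.sqrt (mu / 2) by rewrite sqrtr_gt0 divr_gt0.
move: (Num.sqrt (mu / 2)) k2 k0 => k k2 k0.
have r0 : 0 < Num.sqrt n%:R :> R by rewrite sqrtr_gt0.
have r2 : Num.sqrt n%:R ^+ 2 = n%:R :> R by rewrite sqr_sqrtr // ltW.
case: (lerP (1 / 10) eps) => he.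
  have kA : 20 * (20 * (10 * (10 * (12 * A)))) <= k.
    have B0 : 0 <= 20 * (20 * (10 * (10 * (12 * A)))).
      by do 5!(apply: mulr_ge0; first exact: ler0n).
    rewrite -(@ler_pXn2r _ 2) ?nnegrE ?(ltW k0) ?B0 //.
    by rewrite k2 ler_pdivlMr // mulrC.
  split; last first.
    apply: (ratio_far (c := 1 / 200)) => //; first lra.
    - apply/andP; split; first by lra.
      by have := lerXn2r 2 _ _ he; rewrite !nnegrE !expr2; lra.
    - lra.
    - by move: kA; clear; move: (12 * A) => B; lra.
  apply: (@le_trans _ _ (mu * (1 / 10) ^+ 3)); last first.
    by rewrite ler_pM2l // lerXn2r ?nnegrE //; lra.
  have -> : mu = 2 * k ^+ 2 by rewrite k2; field.
  have kA' : 25 * A <= k by apply: le_trans kA; rewrite -subr_ge0; lra.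
  have : (25 * A) ^+ 2 <= k ^+ 2.
    by rewrite -subr_ge0 subr_sqr mulr_ge0 ?subr_ge0 // addr_ge0 // ?mulr_ge0 // ltW.
  have : A <= A ^+ 2 by rewrite expr2 ler_peMl.
  rewrite exprMn; move: (A ^+ 2) (k ^+ 2) => a c; lra.
have hsA : (60 * A) ^+ 2 <= eps ^+ 2 * Num.sqrt n%:R := le_trans hL hs.
have rs : Num.sqrt n%:R <= expR (eps ^+ 2 * Num.sqrt n%:R / 2).
  rewrite -(@ler_pXn2r _ 2) ?nnegrE ?(ltW r0) ?expR_ge0 //.
  rewrite r2 -expRM_natl mulrC divfK // -[leLHS]lnK ?posrE //.
  by rewrite ler_expR.
move: (Num.sqrt n%:R) r0 r2 rs hsA => r r0 r2 rs hsA {hs hL hmu}.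
rewrite -r2 in muE.
have n9 : 9 / 10 * r ^+ 2 <= mu.
  rewrite muE; have : 0 <= r ^+ 2 * (1 / 10 - eps) by rewrite mulr_ge0 ?sqr_ge0 //; lra.
  lra.
split; last first.
  apply: (ratio_near (r := r)) => //.
    rewrite -(@ler_pXn2r _ 2) ?nnegrE ?(ltW k0) ?mulr_ge0 ?(ltW r0) //.
    rewrite k2 exprMn; have := sqr_ge0 r; lra.
  rewrite k2 muE ler_pM2r // ler_piMr ?sqr_ge0 //; lra.
have A2 : A <= A ^+ 2 by rewrite expr2 ler_peMl.
have As : 2 * A <= eps ^+ 2 * r.
  by apply: le_trans hsA; rewrite exprMn; have := sqr_ge0 A; lra.
have h1 : r ^+ 2 * eps ^+ 4 <= r ^+ 2 * eps ^+ 3.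
  by rewrite ler_wpM2l ?sqr_ge0 // [leLHS]exprS ler_piMl ?exprn_ge0 // ltW.
have h2 : 9 / 10 * r ^+ 2 * eps ^+ 3 <= mu * eps ^+ 3.
  by rewrite ler_wpM2r ?exprn_ge0 // ltW.
have h3 : 2 * A * (2 * A) <= (eps ^+ 2 * r) * (eps ^+ 2 * r).
  by apply: ler_pM; rewrite ?mulr_ge0.
have h4 : (eps ^+ 2 * r) * (eps ^+ 2 * r) = r ^+ 2 * eps ^+ 4 by ring.
rewrite h4 in h3; apply: le_trans h2.
move: (r ^+ 2 * eps ^+ 4) h1 h3 => u h1 h3 {h4 As hsA n9}.
rewrite -mulrA; move: (r ^+ 2 * eps ^+ 3) h1 => v h1.
rewrite expr2 in A2; lra.
Qed.

End Asymptotics.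

Section Regimes.
Variables (R : realType) (p : nat -> R).
Hypothesis hp : forall n, 0 < p n <= 1.

Let hp' n : 0 <= p n <= 1.
Proof. by have := hp n; lra. Qed.

Lemma whp_sparse : (fun n => n%:R `^ (3 / 2) * p n) @ \oo --> (0 : R) ->
  whp p (fun n G =>
    (nb_edges G == 0%N) (+)
    [&& modularity G == mod_score G (components G) :> R &
        mod_score G (components G) == 1 - 1 / (nb_edges G)%:R :> R]).
Proof.
move=> h; apply: whpP => // eta eta0.
have d0 : 0 < Num.min 1 (eta / 4) by rewrite lt_min ltr01 divr_gt0.
have /cvgrPdist_le/(_ _ d0) := h; apply: filter_app; have := near_nat_ge (1 : R).
apply: filter_app; near=> n => n1; rewrite sub0r normrN => hx.
have [p0 p1] := andP (hp n).
pose x := n%:R `^ (3 / 2) * p n.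
have x0 : 0 < x by rewrite mulr_gt0 // powR_gt0; lra.
have [x1 x2] : x <= 1 /\ x <= eta / 4.
  by apply/andP; rewrite -le_min -[leLHS]gtr0_norm.
have xx : x ^+ 2 = n%:R ^+ 3 * p n ^+ 2.
  rewrite exprMn; congr (_ * _).
  by rewrite -[LHS]powR_mulrn ?powR_ge0 // -powRrM -[RHS]powR_mulrn //; congr (_ `^ _); field.
have nx : n%:R * p n <= x.
  by rewrite ler_pM2r // -[leLHS]powRr1 //; apply: (ler_powR n1); lra.
have := prob_degree_ge2 (T := 'I_n) (hp n); rewrite card_ord => hprob.
have l01 : 0 < n%:R * p n <= 1 by rewrite (le_trans nx x1) andbT mulr_gt0 //; lra.
apply: le_trans (gnp_prob_sub (hp' n) _) _; last first.
  apply: le_trans (hprob l01) _.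
  rewrite -xx; have : x ^+ 2 <= x by rewrite expr2 ler_piMl // ltW.
  by move: x2; clear; lra.
move=> G; apply: contraR => /existsPn hd.
have deg1 y : (degree G y <= 1)%N by rewrite leqNgt; exact: hd.
have [m0|m0] := posnP (nb_edges G).
  rewrite m0 /= invr0 mulr0 subr0 negb_and /mod_score m0 expr0n /= mulr0.
  by rewrite invr0 !mul0r subr0 [0 == 1]eq_sym oner_eq0 orbT.
by rewrite /= matching_modularity // eqxx matching_score ?eqxx.
Unshelve. all: by end_near.
Qed.

Lemma whp_subcritical :
  (fun n => n%:R ^+ 2 * p n) @ \oo --> +oo ->
  (\forall n \near \oo,
     n%:R * p n <= 1 - (ln n%:R) `^ (1 / 2) * n%:R `^ (- (1 / 4))) ->
  whp p (fun n G =>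
    [&& modularity G == mod_score G (components G) :> R,
        1 / 288 / (n%:R ^+ 2 * p n * (1 - n%:R * p n))
          <= 1 - mod_score G (components G) &
        1 - mod_score G (components G)
          <= 96 / (n%:R ^+ 2 * p n * (1 - n%:R * p n))]).
Proof.
move=> /cvgryPge hmu hnp; apply: whpP => // eta eta0.
have hsub n := prob_subcritical_score (T := 'I_n) (hp n).
have D0 : 0 < 8 * 27 * 32 * 64 :> R by rewrite !mulr_gt0.
move: (8 * 27 * 32 * 64) D0 hsub => D D0 hsub.
pose A := (3 + D) / eta + 192.
have A0' : 0 < (3 + D) / eta by rewrite divr_gt0 // addr_gt0.
have A1 : 192 <= A by rewrite /A lerDr ltW.
have A0 : 0 < A by apply: lt_le_trans A1; rewrite ltr0n.
have DA : (3 + D) / A <= eta.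
  by rewrite ler_pdivrMr // mulrC -ler_pdivrMr // /A lerDl.
have A1' : 1 <= A by apply: le_trans A1; rewrite ler1n.
have := hmu (2 * (20 * (20 * (10 * (10 * (12 * A))))) ^+ 2); apply: filter_app.
have := near_ln_ge ((60 * A) ^+ 2); apply: filter_app.
move: hnp; apply: filter_app; have := near_nat_ge (10 : R).
apply: filter_app; near=> n => n10 hnp hL hM.
rewrite ler_nat in n10.
have [p0 p1] := andP (hp n).
have n0 : 0 < n%:R :> R by rewrite ltr0n (leq_trans _ n10).
have L0 : 0 < ln n%:R :> R.
  by apply: lt_le_trans hL; rewrite exprn_gt0 // mulr_gt0.
pose a := ln n%:R `^ (1 / 2) : R; pose b := n%:R `^ (- (1 / 4)) : R.
have a0 : 0 < a by exact: powR_gt0.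
have b0 : 0 < b by exact: powR_gt0.
have ab : a * b <= 1 - n%:R * p n by rewrite lerBrDl addrC -lerBrDl.
have eps0 : 0 < 1 - n%:R * p n by apply: lt_le_trans ab; rewrite mulr_gt0.
have a2 : a ^+ 2 = ln n%:R.
  by rewrite /a div1r powR12_sqrt ?(ltW L0) // sqr_sqrtr // ltW.
have b2 : b ^+ 2 = (Num.sqrt n%:R)^-1.
  rewrite -powR_mulrn ?(ltW b0) // /b -powRrM.
  have -> : - (1 / 4) * 2 = - 2^-1 :> R by field.
  by rewrite powRN powR12_sqrt // ltW.
have r0 : 0 < Num.sqrt n%:R :> R by rewrite sqrtr_gt0.
have hs : ln n%:R <= (1 - n%:R * p n) ^+ 2 * Num.sqrt n%:R.
  rewrite -ler_pdivrMr // -b2 -a2 -exprMn.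
  by rewrite lerXn2r ?nnegrE ?(ltW eps0) // mulr_ge0 // ltW.
have [h3 h4] := subcritical_error n10 p0 A1' hL eps0 hM hs.
have := hsub n; rewrite card_ord.
move/(_ n10 eps0 (le_trans A1 h3))/le_trans; apply.
have muA : 100 * A <= n%:R ^+ 2 * p n.
  apply: le_trans hM.
  have B1 : 100 * A <= 20 * (20 * (10 * (10 * (12 * A)))) by clear - A0; lra.
  have : 1 <= 20 * (20 * (10 * (10 * (12 * A)))).
    by apply: le_trans B1; apply: le_trans A1' _; rewrite ler_peMl ?ler1n // ltW.
  move: (20 * (20 * (10 * (10 * (12 * A))))) B1 => B B1 B2.
  have : B <= B ^+ 2 by rewrite expr2 ler_peMl // (le_trans _ B2).
  by clear - B1 A0; lra.
move: h3 h4 muA eps0.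
have mu0 : 0 < n%:R ^+ 2 * p n by rewrite mulr_gt0 // exprn_gt0.
move: (Num.sqrt _) => k; move: (1 - _ * _) => eps.
move: (n%:R ^+ 2 * p n) mu0 => mu mu0 h3 h4 muA eps0.
have t1 : expR (- (mu / 100)) <= A^-1.
  apply: le_trans (expRN_le _) _; first by rewrite divr_gt0.
  by rewrite lef_pV2 ?posrE ?divr_gt0 // ler_pdivlMr // mulrC.
have t2 : expR (- mu) <= A^-1.
  apply: le_trans (expRN_le mu0) _; rewrite lef_pV2 ?posrE //.
  by apply: le_trans muA; rewrite ler_peMl ?ler1n // ltW.
have t3 : D / (mu * eps ^+ 3) <= D / A.
  by rewrite ler_pM2l // lef_pV2 ?posrE // (lt_le_trans A0 h3).
apply: le_trans DA; rewrite [leRHS]mulrDl; move: t3 h4.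
move: (D / A) (D / (mu * _)) (4 * k * _ / _) => u v w h5 h6.
by clear - t1 t2 h5 h6; move: (A^-1) t1 t2 h6 => y; lra.
Unshelve. all: by end_near.
Qed.

Lemma whp_supercritical (epsilon : R) : 0 < epsilon <= 1 / 4 ->
  (\forall n \near \oo, 1 <= n%:R * p n <= 1 + epsilon) ->
  whp p (fun n G =>
    (mod_score G (components G) <= modularity G :> R) &&
    (1 - (4 * epsilon) ^+ 2 < mod_score G (components G))).
Proof.
move=> heps hnp; apply: whpP => // eta eta0.
have [e0 e1] := andP heps.
pose gam := epsilon ^+ 6 / 64.
have gam0 : 0 < gam by rewrite divr_gt0 // exprn_gt0.
have e30 : 0 < epsilon ^+ 3 by rewrite exprn_gt0.
pose c := (epsilon / 16) ^+ 2.
have c0 : 0 < c by rewrite exprn_gt0 // divr_gt0.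
pose K := (Num.truncn (8 / epsilon ^+ 3 + 4 / gam ^+ 2)).+1.
have Kge : 8 / epsilon ^+ 3 + 4 / gam ^+ 2 <= K%:R by apply: ltW; exact: truncnS_gt.
have g20 : 0 < gam ^+ 2 by rewrite exprn_gt0.
have K1 : 8 <= K%:R * epsilon ^+ 3.
  rewrite -ler_pdivrMr //; apply: le_trans Kge; rewrite lerDl.
  by rewrite divr_ge0 // ltW.
have K2 : 4 <= K%:R * gam ^+ 2.
  rewrite -ler_pdivrMr //; apply: le_trans Kge; rewrite lerDr.
  by rewrite divr_ge0 // ltW.
have := near_nat_ge (16 / epsilon ^+ 3); apply: filter_app.
have := near_nat_ge ((K%:R ^+ 2 + 1) / epsilon ^+ 3); apply: filter_app.
have := near_nat_ge (4 / (gam * eta)); apply: filter_app.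
have := near_nat_ge (4 / (c * eta) + 1); apply: filter_app.
move: hnp; apply: filter_app; near=> n => hnp n1 n2 n3 n4.
pose s := (Num.truncn (2 * epsilon * n%:R)).+1.
have sn : 2 * epsilon * n%:R <= s%:R <= 2 * epsilon * n%:R + 1.
  apply/andP; split; first by apply: ltW; exact: truncnS_gt.
  by rewrite /s -natr1 lerD2r truncn_le !mulr_ge0 // ltW.
have := prob_supercritical_score (T := 'I_n) (K := K) (s := s) (hp' n) heps; rewrite card_ord.
have n3' : 16 <= n%:R * epsilon ^+ 3 by rewrite -ler_pdivrMr.
have n4' : K%:R ^+ 2 < n%:R * epsilon ^+ 3.
  by rewrite -ltr_pdivrMr // (lt_le_trans _ n3) // ltr_pM2r ?invr_gt0 // ltrDl.
move/(_ hnp K1 K2 n3' n4' sn)/le_trans; apply.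
have ge0 : 0 < gam * eta by rewrite mulr_gt0.
have ce0 : 0 < c * eta by rewrite mulr_gt0.
have n0 : 0 < n%:R :> R by apply: lt_le_trans n2; rewrite divr_gt0.
have n10 : 0 < n%:R - 1 :> R.
  rewrite subr_gt0; apply: lt_le_trans n1; rewrite ltrDr divr_gt0 //.
have t1 : expR (- (n%:R * gam)) <= eta / 4.
  apply: le_trans (expRN_le _) _; first by rewrite mulr_gt0.
  rewrite -[leRHS]invrK lef_pV2 ?posrE ?invr_gt0 ?divr_gt0 ?mulr_gt0 //.
  rewrite invf_div -ler_pdivrMr // (le_trans _ n2) // le_eqVlt; apply/orP; left.
  by apply/eqP; field; rewrite !lt0r_neq0.
have t2 : expR (- (c * ((n%:R - 1) / 2))) <= eta / 2.
  have m0 : 0 < c * ((n%:R - 1) / 2) by rewrite mulr_gt0 // divr_gt0.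
  apply: le_trans (expRN_le m0) _.
  rewrite -[leRHS]invrK lef_pV2 ?posrE ?invr_gt0 ?divr_gt0 //.
  have : 4 / (c * eta) <= n%:R - 1 by rewrite lerBrDr.
  rewrite invf_div ler_pdivrMr // => h; rewrite ler_pdivrMr //.
  by move: h; lra.
by rewrite -/gam -/c; lra.
Unshelve. all: by end_near.
Qed.

End Regimes.

Theorem theorem1p2 (R : realType) (p : nat -> R)
  (hp : forall n, 0 < p n <= 1) :
  [/\ (* (i) *)
      (fun n => n%:R `^ (3 / 2) * p n) @ \oo --> (0 : R) ->
      whp p (fun n G =>
        (nb_edges G == 0%N) (+)
        [&& modularity G == mod_score G (components G) :> R &
            mod_score G (components G) == 1 - 1 / (nb_edges G)%:R :> R]),
      (* (ii) *)
      (fun n => n%:R ^+ 2 * p n) @ \oo --> +oo ->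
      (\forall n \near \oo,
         n%:R * p n <= 1 - (ln n%:R) `^ (1 / 2) * n%:R `^ (- (1 / 4))) ->
      exists alpha beta : R,
        0 < alpha < beta /\
        whp p (fun n G =>
          [&& modularity G == mod_score G (components G) :> R,
              alpha / (n%:R ^+ 2 * p n * (1 - n%:R * p n))
                <= 1 - mod_score G (components G) &
              1 - mod_score G (components G)
                <= beta / (n%:R ^+ 2 * p n * (1 - n%:R * p n))])
    & (* (iii) *)
      forall epsilon : R, 0 < epsilon <= 1 / 4 ->
      (\forall n \near \oo, 1 <= n%:R * p n <= 1 + epsilon) ->
      whp p (fun n G =>
        (mod_score G (components G) <= modularity G :> R) &&
        (1 - (4 * epsilon) ^+ 2 < mod_score G (components G)))].
Proof.
split; first exact: whp_sparse.
  move=> hmu hnp; exists (1 / 288), 96; split; first by lra.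
  exact: whp_subcritical.
exact: whp_supercritical.
Qed.
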